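(* Let $H$ be a Hopf algebra and let $\psi:K\to L$ be an $H$-Hopf-Galois extension of division algebras. Then, for any positive integer $n$, $$\mathrm{H}^1(H,L^n)=\{1\},$$ where $1$ denotes the distinguished point and $L^n$ is viewed as the extended module $K^n\otimes_KL$ with its canonical $(H,L)$-Hopf module structure $\mathrm{id}_{K^n}\otimes\Delta_L$.
   Context: $k$ is a commutative unital ring, $\otimes=\otimes_k$; algebras are associative unital $k$-algebras; modules are right modules unless otherwise stated. A division algebra is a commutative field or a skew-field. $H$ is a Hopf algebra over $k$, finite-dimensional over $k$ (finitely generated projective as a $k$-module), with multiplication $\mu_H$, unit $\eta_H$, comultiplication $\Delta_H$, counit $\varepsilon_H$, antipode $\sigma_H$. An $H$-comodule algebra is an algebra $S$ with a right $H$-coaction $\Delta_S:S\to S\otimes H$ that is an algebra morphism. An $(H,S)$-Hopf module is an $S$-module $M$ that is also a right $H$-comodule via $\Delta_M:M\to M\otimes H$, with $\Delta_M(ms)=\Delta_M(m)\Delta_S(s)$. $\mathrm{Aut}_S(M)$ is the group of $S$-linear automorphisms of $M$. Hopf-Galois extension. Let $S$ be an $H$-comodule algebra and $R=\{s\in S\mid\Delta_S(s)=s\otimes1\}$. The inclusion $\psi:R\to S$ is an $H$-Hopf-Galois extension if $\psi$ is faithfully flat and the Galois map $\Gamma_\psi:S\otimes_RS\to S\otimes H$, $\Gamma_\psi(s\otimes t)=s\Delta_S(t)$, is a $k$-linear isomorphism. Here $R=K$, $S=L$ are division algebras. Hopf cohomology set. Let $M$ be an $(H,S)$-Hopf module and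 $\mathrm{W}^n_k(M)=\mathrm{Hom}_k(M,M\otimes H^{\otimes n})$. It is a monoid for the product $\odot$ given by $\varphi\odot\varphi'=\varphi\circ\varphi'$ if $n=0$ and $\varphi\odot\varphi'=(\mathrm{id}_M\otimes\mu_H^{\otimes n})\circ(\mathrm{id}_M\otimes\chi_n)\circ(\varphi\otimes\mathrm{id}_H^{\otimes n})\circ\varphi'$ if $n>0$, where $\chi_n((a_1\otimes\cdots\otimes a_n)\otimes(b_1\otimes\cdots\otimes b_n))=(a_1\otimes b_1)\otimes\cdots\otimes(a_n\otimes b_n)$. Let $T$ be the flip of $H\otimes H$. For $k$-linear $\varphi:M\to M$ and $\Phi:M\to M\otimes H$ put $d^0\varphi=(\mathrm{id}_M\otimes\mu_H)\circ(\Delta_M\otimes\mathrm{id}_H)\circ(\varphi\otimes\sigma_H)\circ\Delta_M$, $d^1\varphi=(\mathrm{id}_M\otimes\eta_H)\circ\varphi$, $d^0\Phi=(\mathrm{id}_M\otimes\mu_H\otimes\mathrm{id}_H)\circ(\Delta_M\otimes T)\circ(\Phi\otimes\sigma_H)\circ\Delta_M$, $d^1\Phi=(\mathrm{id}_M\otimes\Delta_H)\circ\Phi$, $d^2\Phi=\Phi\otimes\eta_H$ (that is, $m\mapsto\Phi(m)\otimes 1$). $\mathrm{Z}^1(H,M)$ is the set of $\Phi\in\mathrm{W}^1_k(M)$ such that $\Phi(ms)=\Phi(m)s$ for all $m\in M,s\in S$ (where $(m\otimes h)s=ms\otimes h$), $(\mathrm{id}_M\otimes\varepsilon_H)\circ\Phi=\mathrm{id}_M$,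 and $d^2\Phi\odot d^0\Phi=d^1\Phi$. The group $\mathrm{Aut}_S(M)$ acts on the right on $\mathrm{Z}^1(H,M)$ by $\Phi\leftharpoonup f=d^1f^{-1}\odot\Phi\odot d^0f$; $\mathrm{H}^1(H,M)$ is the set of orbits, pointed by the class of $\mathrm{id}_M\otimes\eta_H$. *)

(* Defs.v *)
From HB Require Import structures.
From mathcomp Require Import all_boot all_order all_algebra.
From mathcomp Require Import boolp classical_sets.

Set Implicit Arguments.
Unset Strict Implicit.
Unset Printing Implicit Defensive.

Import GRing.Theory.
Local Open Scope ring_scope.
Local Open Scope quotient_scope.

Declare Scope tensor_scope.
Delimit Scope tensor_scope with T.
Local Open Scope tensor_scope.

Section LinearMaps.
Variable k : comNzRingType.

Lemma lin_id (P : lmodType k) : linear (@id P).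
Proof. by []. Qed.

Lemma lin_comp (P Q U : lmodType k) (f : Q -> U) (g : P -> Q) :
  linear f -> linear g -> linear (f \o g).
Proof. by move=> lf lg c x y; rewrite /= lg lf. Qed.

Lemma lin_scale (P Q : lmodType k) (f : P -> Q) c x :
  linear f -> f (c *: x) = c *: f x.
Proof.
move=> lf; have f0 : f 0 = 0.
  by apply: (addrI (f 0)); have := lf 1 0 0; rewrite !scale1r !addr0.
by have := lf c x 0; rewrite f0 !addr0.
Qed.

Lemma lin_sum (P Q : lmodType k) (f : P -> Q) (I : Type) (s : seq I)
    (F : I -> P) :
  linear f -> f (\sum_(i <- s) F i) = \sum_(i <- s) f (F i).
Proof.
move=> lf.
have fD x y : f (x + y) = f x + f y by have := lf 1 x y; rewrite !scale1r.
have f0 : f 0 = 0 by apply: (addrI (f 0)); rewrite -fD !addr0.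
by elim: s => [|i s IH]; rewrite ?big_nil ?big_cons// fD IH.
Qed.

End LinearMaps.

(* Tensor products.  [M ⊗_R N] is the k-module of finite formal sums of pure
   tensors [(m, n)], two sums being identified when no k-bilinear R-balanced
   map separates them.  The right action [ra] of [R] on [M] and the left action
   [la] of [R] on [N] are explicit, so that one construction serves for [R = k]
   and for a noncommutative algebra [R]. *)
Section Tensor.
Variables (k : comNzRingType) (M N : lmodType k) (R : Type).
Variables (ra : M -> R -> M) (la : R -> N -> N).

Record balanced (P : lmodType k) (f : M -> N -> P) : Prop := Balanced {
  bal_linl : forall n, linear (f^~ n);
  bal_linr : forall m, linear (f m);
  bal_mid : forall m r n, f (ra m r) n = f m (la r n) }.

Definition tsum (P : lmodType k) (f : M -> N -> P) (s : seq (M * N)) : P :=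
  \sum_(x <- s) f x.1 x.2.

Definition tequiv (s t : seq (M * N)) : bool :=
  `[< forall (P : lmodType k) (f : M -> N -> P),
        balanced f -> tsum f s = tsum f t >].

Lemma tequiv_refl : reflexive tequiv.
Proof. by move=> s; apply/asboolP. Qed.

Lemma tequiv_sym : symmetric tequiv.
Proof. by move=> s t; apply/idP/idP => /asboolP h; apply/asboolP => P f /h. Qed.

Lemma tequiv_trans : transitive tequiv.
Proof.
move=> t s u /asboolP h /asboolP h'; apply/asboolP => P f bf.
by rewrite (h _ _ bf) h'.
Qed.

Canonical tequiv_equiv := EquivRel tequiv tequiv_refl tequiv_sym tequiv_trans.

Definition tensor_over := {eq_quot tequiv}.
HB.instance Definition _ := Choice.on tensor_over.
HB.instance Definition _ := EqQuotient.on tensor_over.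

Implicit Types x y z : tensor_over.

Definition tpure (m : M) (n : N) : tensor_over := \pi_tensor_over [:: (m, n)].

(* The linear map induced by a balanced [f]; a junk value if [f] is not
   balanced. *)
Definition tlift (P : lmodType k) (f : M -> N -> P) (x : tensor_over) : P :=
  tsum f (repr x).

Lemma tlift_pi (P : lmodType k) (f : M -> N -> P) s :
  balanced f -> tlift f (\pi_tensor_over s) = tsum f s.
Proof.
move=> bf; rewrite /tlift; have /eqmodP/asboolP h : repr (\pi_tensor_over s) = s
  %[mod tensor_over] by rewrite reprK.
exact: h.
Qed.

Lemma tlift_sep x y :
  (forall (P : lmodType k) (f : M -> N -> P), balanced f ->
     tlift f x = tlift f y) -> x = y.
Proof.
move=> h; rewrite -[x]reprK -[y]reprK; apply/eqmodP/asboolP => P f bf.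
exact: (h P f bf).
Qed.

Definition tadd x y := \pi_tensor_over (repr x ++ repr y).
Definition tzero := \pi_tensor_over [::].
Definition tscale (c : k) x :=
  \pi_tensor_over [seq (c *: p.1, p.2) | p <- repr x].
Definition topp x := tscale (-1) x.

Lemma tlift_add (P : lmodType k) (f : M -> N -> P) x y : balanced f ->
  tlift f (tadd x y) = tlift f x + tlift f y.
Proof. by move=> bf; rewrite tlift_pi // /tsum big_cat. Qed.

Lemma tlift_zero (P : lmodType k) (f : M -> N -> P) : balanced f ->
  tlift f tzero = 0.
Proof. by move=> bf; rewrite tlift_pi // /tsum big_nil. Qed.

Lemma tlift_scale (P : lmodType k) (f : M -> N -> P) c x : balanced f ->
  tlift f (tscale c x) = c *: tlift f x.
Proof.
move=> bf; rewrite tlift_pi // /tlift /tsum big_map scaler_sumr.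
by apply: eq_bigr => p _; rewrite (lin_scale c p.1 (bal_linl bf p.2)).
Qed.

Lemma taddA : associative tadd.
Proof. by move=> x y z; apply: tlift_sep => P f bf; rewrite !tlift_add// addrA. Qed.
Lemma taddC : commutative tadd.
Proof. by move=> x y; apply: tlift_sep => P f bf; rewrite !tlift_add// addrC. Qed.
Lemma tadd0 : left_id tzero tadd.
Proof.
by move=> x; apply: tlift_sep => P f bf; rewrite tlift_add// tlift_zero// add0r.
Qed.
Lemma taddN : left_inverse tzero topp tadd.
Proof.
move=> x; apply: tlift_sep => P f bf.
by rewrite tlift_add// tlift_zero// tlift_scale// scaleN1r addNr.
Qed.
HB.instance Definition _ :=
  GRing.isZmodule.Build tensor_over taddA taddC tadd0 taddN.

Lemma tscaleA a b x : tscale a (tscale b x) = tscale (a * b) x.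
Proof. by apply: tlift_sep => P f bf; rewrite !tlift_scale// scalerA. Qed.
Lemma tscale1 : left_id 1 tscale.
Proof. by move=> x; apply: tlift_sep => P f bf; rewrite tlift_scale// scale1r. Qed.
Lemma tscaleDr : right_distributive tscale +%R.
Proof.
move=> a x y; apply: tlift_sep => P f bf.
by rewrite tlift_scale// !tlift_add// !tlift_scale// scalerDr.
Qed.
Lemma tscaleDl x : {morph tscale^~ x : a b / a + b}.
Proof.
move=> a b; apply: tlift_sep => P f bf.
by rewrite tlift_scale// tlift_add// !tlift_scale// scalerDl.
Qed.
HB.instance Definition _ := GRing.Zmodule_isLmodule.Build k tensor_over
  tscaleA tscale1 tscaleDr tscaleDl.

Lemma tlift_linear (P : lmodType k) (f : M -> N -> P) :
  balanced f -> linear (tlift f).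
Proof. by move=> bf c x y; rewrite [LHS]tlift_add// tlift_scale. Qed.

Lemma tlift_pure (P : lmodType k) (f : M -> N -> P) m n :
  balanced f -> tlift f (tpure m n) = f m n.
Proof. by move=> bf; rewrite tlift_pi// /tsum big_seq1. Qed.

Lemma tpure_balanced : balanced tpure.
Proof.
split=> [n c m m'|m c n n'|m r n]; apply: tlift_sep => P f bf;
  rewrite ?tlift_linear// !tlift_pure//.
- exact: bal_linl.
- exact: bal_linr.
- exact: bal_mid.
Qed.

Lemma tensor_sum x : x = \sum_(p <- repr x) tpure p.1 p.2.
Proof.
apply: tlift_sep => P f bf; rewrite {1}/tlift /tsum.
elim: (repr x) => [|p s IH]; first by rewrite !big_nil [RHS]tlift_zero.
by rewrite !big_cons [RHS]tlift_add// tlift_pure// IH.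
Qed.

End Tensor.

Arguments tpure {k M N R ra la}.
Arguments tlift {k M N R ra la P}.

Lemma tensor_ext (k : comNzRingType) (M N : lmodType k) (R : Type) (ra : M -> R -> M)
    (la : R -> N -> N) (P : lmodType k) (f g : tensor_over ra la -> P) :
  linear f -> linear g -> (forall m n, f (tpure m n) = g (tpure m n)) ->
  f =1 g.
Proof.
move=> lf lg fg x; rewrite (tensor_sum x) !lin_sum//.
by apply: eq_bigr => p _; apply: fg.
Qed.

Notation "M ⨂ N" :=
  (@tensor_over _ M N _ (fun x c => c *: x) (fun c y => c *: y))
  (at level 40, left associativity) : type_scope.
Notation "m ⊗ n" :=
  (@tpure _ _ _ _ (fun x c => c *: x) (fun c y => c *: y) m n)
  (at level 40, left associativity) : tensor_scope.

Section TensorMaps.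
Variable k : comNzRingType.
Implicit Types A B C D : lmodType k.

Definition tmap A B C D (f : A -> C) (g : B -> D) : A ⨂ B -> C ⨂ D :=
  tlift (fun a b => f a ⊗ g b).

Definition tassoc A B C : (A ⨂ B) ⨂ C -> A ⨂ (B ⨂ C) :=
  tlift (fun ab c => tlift (fun a b => a ⊗ (b ⊗ c)) ab).

Definition tassoc_inv A B C : A ⨂ (B ⨂ C) -> (A ⨂ B) ⨂ C :=
  tlift (fun a bc => tlift (fun b c => (a ⊗ b) ⊗ c) bc).

Definition tflip A B : A ⨂ B -> B ⨂ A := tlift (fun a b => b ⊗ a).

Definition trunit A : A ⨂ k^o -> A := tlift (fun a (c : k^o) => c *: a).
Definition tlunit A : k^o ⨂ A -> A := tlift (fun (c : k^o) a => c *: a).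

(* [tprod f g (a ⊗ a') (b ⊗ b') = f a b ⊗ g a' b'] *)
Definition tprod A B C A' B' C' (f : A -> B -> C) (g : A' -> B' -> C')
    (x : A ⨂ A') (y : B ⨂ B') : C ⨂ C' :=
  tlift (fun a a' => tmap (f a) (g a') y) x.

Lemma balancedP A B C (f : A -> B -> C) :
  (forall b, linear (f^~ b)) -> (forall a, linear (f a)) ->
  balanced (fun a c => c *: a) (fun c b => c *: b) f.
Proof.
move=> fl fr; split=> // a c b.
by rewrite (lin_scale c a (fl b)) (lin_scale c b (fr a)).
Qed.

Lemma pure_bal A B : balanced (fun a c => c *: a) (fun c b => c *: b)
  (fun (a : A) (b : B) => a ⊗ b).
Proof. exact: tpure_balanced. Qed.

Lemma pure_linl A B (b : B) : linear (fun a : A => a ⊗ b).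
Proof. exact: (bal_linl (pure_bal A B)). Qed.
Lemma pure_linr A B (a : A) : linear (fun b : B => a ⊗ b).
Proof. exact: (bal_linr (pure_bal A B)). Qed.

Lemma tmap_bal A B C D (f : A -> C) (g : B -> D) : linear f -> linear g ->
  balanced (fun a c => c *: a) (fun c b => c *: b) (fun a b => f a ⊗ g b).
Proof.
move=> lf lg; apply: balancedP => [b|a] c x y /=.
- by rewrite lf pure_linl.
- by rewrite lg pure_linr.
Qed.

Lemma tmap_linear A B C D (f : A -> C) (g : B -> D) :
  linear f -> linear g -> linear (tmap f g).
Proof. by move=> lf lg; apply/tlift_linear/tmap_bal. Qed.

Lemma tmapE A B C D (f : A -> C) (g : B -> D) a b :
  linear f -> linear g -> tmap f g (a ⊗ b) = f a ⊗ g b.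
Proof. by move=> lf lg; rewrite /tmap tlift_pure//; apply: tmap_bal. Qed.

Lemma tmap_comp A B C D A' B' (f : A -> C) (g : B -> D) (f' : A' -> A)
    (g' : B' -> B) x :
  linear f -> linear g -> linear f' -> linear g' ->
  tmap f g (tmap f' g' x) = tmap (f \o f') (g \o g') x.
Proof.
move=> lf lg lf' lg'.
have lff := lin_comp lf lf'; have lgg := lin_comp lg lg'.
move: x; apply: (@tensor_ext _ _ _ _ _ _ _ (tmap f g \o tmap f' g')).
- by apply: lin_comp; apply: tmap_linear.
- exact: tmap_linear.
- by move=> a b; rewrite /= !tmapE.
Qed.

Lemma tassoc_inner_bal A B C (c : C) :
  balanced (fun a c => c *: a) (fun c b => c *: b)
    (fun (a : A) (b : B) => a ⊗ (b ⊗ c)).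
Proof.
apply: balancedP => [b|a]; first exact: pure_linl.
exact: lin_comp (pure_linr _) (pure_linl _).
Qed.

Lemma tassoc_bal A B C : balanced (fun a c => c *: a) (fun c b => c *: b)
  (fun (ab : A ⨂ B) (c : C) => tlift (fun a b => a ⊗ (b ⊗ c)) ab).
Proof.
apply: balancedP => [c|ab].
  by apply: tlift_linear; apply: tassoc_inner_bal.
move=> c x y; move: ab.
have lt z : linear (tlift (fun a b => a ⊗ (b ⊗ z)) : A ⨂ B -> A ⨂ (B ⨂ C)).
  by apply: tlift_linear; apply: tassoc_inner_bal.
apply: tensor_ext => //.
  move=> d u v; rewrite !lt !scalerDr !scalerA mulrC -!addrA; congr (_ + _).
  by rewrite addrCA.
by move=> a b; rewrite !tlift_pure ?pure_linr//; apply: tassoc_inner_bal.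
Qed.

Lemma tassoc_linear A B C : linear (@tassoc A B C).
Proof. by apply: tlift_linear; apply: tassoc_bal. Qed.

Lemma tassocE A B C (a : A) (b : B) (c : C) :
  tassoc ((a ⊗ b) ⊗ c) = a ⊗ (b ⊗ c).
Proof.
rewrite /tassoc tlift_pure ?tlift_pure//; first exact: tassoc_inner_bal.
exact: tassoc_bal.
Qed.

Lemma trunit_bal A : balanced (fun a c => c *: a) (fun c b => c *: b)
  (fun (a : A) (c : k^o) => (c : k) *: a).
Proof.
apply: balancedP => [c|a] d x y /=.
- by rewrite scalerDr !scalerA mulrC.
- by rewrite scalerDl -scalerA.
Qed.

Lemma trunit_linear A : linear (@trunit A).
Proof. by apply: tlift_linear; apply: trunit_bal. Qed.

Lemma trunitE A (a : A) (c : k^o) : trunit (a ⊗ c) = (c : k) *: a.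
Proof. by rewrite /trunit tlift_pure//; apply: trunit_bal. Qed.

Lemma tassoc_map A B C A' B' C' (f : A -> A') (g : B -> B')
    (h : C -> C') x : linear f -> linear g -> linear h ->
  tassoc (tmap (tmap f g) h x) = tmap f (tmap g h) (tassoc x).
Proof.
move=> lf lg lh; move: x.
have lfg := tmap_linear lf lg; have lgh := tmap_linear lg lh.
apply: (@tensor_ext _ _ _ _ _ _ _ (@tassoc _ _ _ \o tmap (tmap f g) h)
  (tmap f (tmap g h) \o @tassoc _ _ _)).
- by apply: lin_comp; [exact: tassoc_linear|exact: tmap_linear].
- by apply: lin_comp; [exact: tmap_linear|exact: tassoc_linear].
move=> ab c /=; rewrite tmapE//; move: ab.
apply: (@tensor_ext _ _ _ _ _ _ _
  (fun ab => tassoc (tmap f g ab ⊗ h c))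
  (fun ab => tmap f (tmap g h) (tassoc (ab ⊗ c)))).
- apply: (lin_comp (@tassoc_linear _ _ _)).
  by apply: (@lin_comp _ _ _ _ (fun z => z ⊗ h c)) => //; exact: pure_linl.
- apply: (lin_comp (tmap_linear lf lgh)).
  by apply: (lin_comp (@tassoc_linear _ _ _)); exact: pure_linl.
by move=> a b; rewrite tmapE// !tassocE !tmapE.
Qed.

Lemma trunit_map A A' (f : A -> A') x : linear f ->
  trunit (tmap f id x) = f (trunit x).
Proof.
move=> lf; move: x; have lr B := @trunit_linear B.
apply: (@tensor_ext _ _ _ _ _ _ _ (@trunit _ \o tmap f id)
  (f \o @trunit _)).
- exact: (lin_comp (@trunit_linear A') (tmap_linear lf (@lin_id k k^o))).
- exact: (lin_comp lf (@trunit_linear A)).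
move=> a c /=; rewrite tmapE//.
by rewrite !trunitE (lin_scale c a lf).
Qed.

Section Tprod.
Variables (A B C A' B' C' : lmodType k) (f : A -> B -> C) (g : A' -> B' -> C').
Hypotheses (fl : forall b, linear (f^~ b)) (fr : forall a, linear (f a)).
Hypotheses (gl : forall b, linear (g^~ b)) (gr : forall a, linear (g a)).

Lemma tprod_bal y : balanced (fun a c => c *: a) (fun c b => c *: b)
  (fun a a' => tmap (f a) (g a') y).
Proof.
apply: balancedP => [a'|a] c u v; rewrite /tmap /tlift /tsum scaler_sumr;
  rewrite -big_split; apply: eq_bigr => p _ /=.
- by rewrite fl pure_linl.
- by rewrite gl pure_linr.
Qed.

Lemma tprod_linl y : linear (tprod f g ^~ y).
Proof. by apply: tlift_linear; apply: tprod_bal. Qed.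

Lemma tprod_purel a a' y : tprod f g (a ⊗ a') y = tmap (f a) (g a') y.
Proof. by rewrite /tprod tlift_pure//; apply: tprod_bal. Qed.

Lemma tprodE a a' b b' : tprod f g (a ⊗ a') (b ⊗ b') = f a b ⊗ g a' b'.
Proof. by rewrite tprod_purel tmapE. Qed.

Lemma tprod_linr x : linear (tprod f g x).
Proof.
move=> c y y'; rewrite /tprod /tlift /tsum scaler_sumr.
rewrite -big_split; apply: eq_bigr => p _ /=.
by rewrite tmap_linear.
Qed.
End Tprod.

End TensorMaps.

Section AlgebraTensor.
Variables (k : comNzRingType) (A B : algType k).

Lemma mul_linl (C : algType k) (b : C) : linear (fun a : C => a * b).
Proof. by move=> c x y; rewrite mulrDl -scalerAl. Qed.
Lemma mul_linr (C : algType k) (a : C) : linear (fun b : C => a * b).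
Proof. by move=> c x y; rewrite mulrDr -scalerAr. Qed.

(* The product of the algebra [A ⨂ B].  No ring instance is declared: [A ⨂ B]
   may be zero, and [algType] requires [1 != 0]. *)
Definition tmul : A ⨂ B -> A ⨂ B -> A ⨂ B := tprod *%R *%R.

Definition mul_map : A ⨂ A -> A := tlift *%R.
End AlgebraTensor.

HB.mixin Record isHopfAlgebra (k : comNzRingType) H of GRing.Algebra k H := {
  hcomul : {linear H -> H ⨂ H};
  hcounit : {linear H -> k^o};
  hantipode : {linear H -> H};
  hcomulA : forall h,
    tassoc (tmap hcomul id (hcomul h)) = tmap id hcomul (hcomul h);
  hcounitl : forall h, tlunit (tmap hcounit id (hcomul h)) = h;
  hcounitr : forall h, trunit (tmap id hcounit (hcomul h)) = h;
  hcomul1 : hcomul 1 = 1 ⊗ 1;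
  hcomulM : forall h h', hcomul (h * h') = tmul (hcomul h) (hcomul h');
  hcounit1 : hcounit 1 = 1;
  hcounitM : forall h h', hcounit (h * h') = hcounit h * hcounit h';
  hantipodel : forall h,
    mul_map (tmap hantipode id (hcomul h)) = (hcounit h : k) *: 1;
  hantipoder : forall h,
    mul_map (tmap id hantipode (hcomul h)) = (hcounit h : k) *: 1 }.

#[short(type="hopfAlgType")]
HB.structure Definition HopfAlgebra (k : comNzRingType) :=
  {H of isHopfAlgebra k H & GRing.Algebra k H}.

Definition is_coaction (k : comNzRingType) (H : hopfAlgType k) (M : lmodType k)
    (d : M -> M ⨂ H) : Prop :=
  (forall m, tassoc (tmap d id (d m)) = tmap id hcomul (d m)) /\
  (forall m, trunit (tmap id hcounit (d m)) = m).

HB.mixin Record isComodAlgebra (k : comNzRingType) (H : hopfAlgType k) S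
    of GRing.Algebra k S := {
  coact : {linear S -> S ⨂ H};
  coactP : is_coaction coact;
  coact1 : coact 1 = 1 ⊗ 1;
  coactM : forall s t, coact (s * t) = tmul (coact s) (coact t) }.

#[short(type="comodAlgType")]
HB.structure Definition ComodAlgebra (k : comNzRingType) (H : hopfAlgType k) :=
  {S of isComodAlgebra k H S & GRing.Algebra k S}.

(* Right S-modules.  The k-module structure, which is determined by the action
   of [S], is made explicit. *)
Record rmodule (k : comNzRingType) (S : algType k) := RModule {
  rmod_sort :> lmodType k;
  ract : rmod_sort -> S -> rmod_sort;
  ract_linl : forall s, linear (ract^~ s);
  ract_linr : forall m, linear (ract m);
  ract1 : forall m, ract m 1 = m;
  ractA : forall m s t, ract (ract m s) t = ract m (s * t) }.

Definition rlinear (k : comNzRingType) (S : algType k) (M N : rmodule S)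
    (f : M -> N) : Prop :=
  {morph f : x y / x + y} /\ forall m s, f (ract m s) = ract (f m) s.

Section HopfModule.
Variables (k : comNzRingType) (H : hopfAlgType k) (S : comodAlgType H).

Record hopf_module := HopfModule {
  hmod_rmod :> rmodule S;
  hmod_coact : {linear hmod_rmod -> hmod_rmod ⨂ H};
  hmod_coactP : is_coaction hmod_coact;
  hmod_coactM : forall m s,
    hmod_coact (ract m s) = tprod (@ract _ _ _) *%R (hmod_coact m) (coact s) }.

End HopfModule.

Section Coinvariants.
Variables (k : comNzRingType) (H : hopfAlgType k) (S : comodAlgType H).

Definition coinvariant : {pred S} := fun s => coact s == s ⊗ 1.

Lemma tmulE (A B : algType k) (a a' : A) (b b' : B) :
  tmul (a ⊗ b) (a' ⊗ b') = (a * a') ⊗ (b * b').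
Proof. by apply: tprodE => c; first [exact: mul_linl|exact: mul_linr]. Qed.

Fact coinvariant_subalg : GRing.subsemialg_closed coinvariant.
Proof.
apply: GRing.subalg_closed_semi; split.
- by rewrite unfold_in coact1.
- move=> c s t /eqP cs /eqP ct; rewrite unfold_in linearP cs ct.
  by rewrite (pure_linl 1).
- move=> s t /eqP cs /eqP ct; rewrite unfold_in coactM cs ct.
  by rewrite tmulE mulr1.
Qed.

Record coinv := Coinv { coinv_val : S; coinv_valP : coinv_val \in coinvariant }.

HB.instance Definition _ := [isSub for coinv_val].
HB.instance Definition _ := [Choice of coinv by <:].
HB.instance Definition _ :=
  GRing.SubChoice_isSubAlgebra.Build k S coinvariant coinv coinvariant_subalg.

End Coinvariants.

Section Extension.
Variables (k : comNzRingType) (R S : algType k) (psi : {lrmorphism R -> S}).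

(* [V ⊗_R S], with [S] a left R-module through [psi]. *)
Definition ext_tensor (V : rmodule R) : lmodType k :=
  tensor_over (@ract _ _ V) (fun r (s : S) => psi r * s).

Definition ext_map (V W : rmodule R) (f : V -> W) :
  ext_tensor V -> ext_tensor W := tlift (fun v s => tpure (f v) s).

Definition ext_ract (V : rmodule R) (x : ext_tensor V) (s : S) : ext_tensor V :=
  tlift (fun v t => tpure v (t * s)) x.

Section ExtModule.
Variable V : rmodule R.

Lemma ext_pure_bal : balanced (@ract _ _ V) (fun r (s : S) => psi r * s)
  (fun v s => tpure v s : ext_tensor V).
Proof. exact: tpure_balanced. Qed.

Lemma ext_ract_bal s : balanced (@ract _ _ V) (fun r (s : S) => psi r * s)
  (fun v t => tpure v (t * s) : ext_tensor V).
Proof.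
split=> [t|v|v r t].
- exact: (bal_linl ext_pure_bal).
- by move=> c t t'; rewrite mul_linl (bal_linr ext_pure_bal).
- by rewrite (bal_mid ext_pure_bal) mulrA.
Qed.

Lemma ext_ract_linl s : linear (@ext_ract V ^~ s).
Proof. by apply: tlift_linear; apply: ext_ract_bal. Qed.

Lemma ext_ractE v t s : ext_ract (tpure v t : ext_tensor V) s = tpure v (t * s).
Proof. by rewrite /ext_ract tlift_pure//; apply: ext_ract_bal. Qed.

Lemma ext_ract_linr x : linear (@ext_ract V x).
Proof.
move=> c s s'; rewrite /ext_ract /tlift /tsum scaler_sumr -big_split.
by apply: eq_bigr => p _ /=; rewrite mul_linr (bal_linr ext_pure_bal).
Qed.

Lemma ext_ract1 x : @ext_ract V x 1 = x.
Proof.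
move: x; apply: tensor_ext => [||v t] //; first exact: ext_ract_linl.
by rewrite ext_ractE mulr1.
Qed.

Lemma ext_ractA x s t : @ext_ract V (ext_ract x s) t = ext_ract x (s * t).
Proof.
move: x; apply: (@tensor_ext _ _ _ _ _ _ _ (@ext_ract V ^~ t \o @ext_ract V ^~ s)).
- by apply: lin_comp; apply: ext_ract_linl.
- exact: ext_ract_linl.
- by move=> v u; rewrite /= !ext_ractE mulrA.
Qed.

Definition ext_rmodule : rmodule S :=
  RModule ext_ract_linl ext_ract_linr ext_ract1 ext_ractA.

End ExtModule.

(* [S] is faithfully flat as a left R-module: a sequence of right R-modules is
   exact if and only if its image under [- ⊗_R S] is. *)
Definition exact_at (A B C : lmodType k) (f : A -> B) (g : B -> C) : Prop :=
  forall b, g b = 0 <-> exists a, f a = b.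

Definition faithfully_flat : Prop :=
  forall (U V W : rmodule R) (f : U -> V) (g : V -> W),
    rlinear f -> rlinear g ->
    exact_at f g <-> exact_at (ext_map f) (ext_map g).

End Extension.

Section HopfGalois.
Variables (k : comNzRingType) (H : hopfAlgType k) (S : comodAlgType H).

Definition coinv_incl : coinv S -> S := \val.
HB.instance Definition _ := GRing.RMorphism.on coinv_incl.
HB.instance Definition _ := GRing.Linear.on coinv_incl.

Lemma coact_coinv r : coact (coinv_incl r) = coinv_incl r ⊗ 1.
Proof. exact/eqP/(valP r). Qed.

Definition galois_source : lmodType k :=
  tensor_over (fun (s : S) r => s * coinv_incl r)
              (fun r (t : S) => coinv_incl r * t).

Definition galois_map : galois_source -> S ⨂ H :=
  tlift (fun s t => tmap ( *%R s) id (coact t)).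

(* The inclusion of the coinvariant subalgebra into [S] is an H-Hopf-Galois
   extension. *)
Definition hopf_galois : Prop :=
  faithfully_flat coinv_incl /\ bijective galois_map.

(* The Hopf module [V ⊗_R S] with coaction [id ⊗ coact], where
   [V ⊗_R (S ⨂ H)] is identified with [(V ⊗_R S) ⨂ H]. *)
Section ExtHopf.
Variable V : rmodule (coinv S).

Local Notation E := (ext_rmodule coinv_incl V).
Definition epure (v : V) (s : S) : E := tpure v s.

Definition ext_coact : E -> E ⨂ H :=
  tlift (fun v s => tmap (epure v) id (coact s)).

Lemma epure_linl s : linear (epure^~ s).
Proof. exact: (bal_linl (ext_pure_bal coinv_incl V)). Qed.
Lemma epure_linr v : linear (epure v).
Proof. exact: (bal_linr (ext_pure_bal coinv_incl V)). Qed.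

Lemma ext_coact_bal : balanced (@ract _ _ V) (fun r (s : S) => coinv_incl r * s)
  (fun v s => tmap (epure v) id (coact s) : E ⨂ H).
Proof.
split=> [s|v|v r s].
- move=> c v v'; rewrite /tmap /tlift /tsum scaler_sumr -big_split.
  by apply: eq_bigr => p _ /=; rewrite epure_linl pure_linl.
- apply: lin_comp (tmap_linear (epure_linr v) (@lin_id _ _)) _.
  exact: linearP.
- rewrite coactM coact_coinv /tmul tprod_purel;
    try by move=> ?; first [exact: mul_linl|exact: mul_linr].
  rewrite tmap_comp; try first [exact: epure_linr|exact: mul_linr|exact: lin_id].
  rewrite /tmap /tlift /tsum; apply: eq_bigr => p _ /=; rewrite mul1r; congr (_ ⊗ _).
  exact: (bal_mid (ext_pure_bal coinv_incl V)).
Qed.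

Lemma ext_coact_linear : linear ext_coact.
Proof. by apply: tlift_linear; apply: ext_coact_bal. Qed.

Lemma ext_coactE v s : ext_coact (epure v s) = tmap (epure v) id (coact s).
Proof. by rewrite /ext_coact tlift_pure//; apply: ext_coact_bal. Qed.

Lemma ext_coactP : is_coaction ext_coact.
Proof.
have [cA c1] := @coactP _ _ S.
have lc := ext_coact_linear; have li := @lin_id k.
have lh : linear (@hcomul _ H) by exact: linearP.
have le : linear (@hcounit _ H) by exact: linearP.
have ls : linear (@coact _ _ S) by exact: linearP.
split.
- have l1 : linear (tmap ext_coact (@id H)) by exact: (tmap_linear lc (li H)).
  have l2 : linear (tmap (@id E) (@hcomul _ H)) by exact: (tmap_linear (li E) lh).
  apply: (@tensor_ext _ _ _ _ _ _ _
    (@tassoc _ _ _ _ \o (tmap ext_coact id \o ext_coact))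
    (tmap id hcomul \o ext_coact)).
  + by apply: lin_comp; [exact: tassoc_linear|exact: lin_comp].
  + exact: lin_comp.
  move=> v s; have lv := epure_linr v.
  have lvi : linear (tmap (epure v) (@id H)) by exact: (tmap_linear lv (li H)).
  rewrite /= -/(epure v s) ext_coactE !tmap_comp//.
  have -> : tmap (ext_coact \o epure v) (id \o id) (coact s)
      = tmap (tmap (epure v) (@id H)) id (tmap coact id (coact s)).
    rewrite tmap_comp// /tmap /tlift /tsum; apply: eq_bigr => p _ /=.
    by rewrite ext_coactE.
  rewrite tassoc_map// cA tmap_comp//; last exact: tmap_linear.
  rewrite /tmap /tlift /tsum; apply: eq_bigr => p _ /=; congr (_ ⊗ _).
  by rewrite [RHS]tensor_sum.
- apply: (@tensor_ext _ _ _ _ _ _ _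
    (@trunit _ _ \o (tmap id hcounit \o ext_coact)) id) => //.
    apply: lin_comp; first exact: trunit_linear.
    by apply: lin_comp => //; exact: tmap_linear.
  move=> v s; have lv := epure_linr v.
  rewrite /= -/(epure v s) ext_coactE tmap_comp//.
  transitivity (trunit (tmap (epure v) (@id k^o) (tmap id hcounit (coact s)))).
    by rewrite tmap_comp.
  by rewrite trunit_map// c1.
Qed.

Lemma ext_coactM (x : E) s :
  ext_coact (ract x s) = tprod (@ract _ _ E) *%R (ext_coact x) (coact s).
Proof.
have ll t : linear (@ract _ _ E ^~ t) by exact: ract_linl.
have lr y : linear (@ract _ _ E y) by exact: ract_linr.
have ml := @mul_linl k H; have mr := @mul_linr k H.
have lc := ext_coact_linear; have li := @lin_id k.
move: x; apply: (@tensor_ext _ _ _ _ _ _ _ (ext_coact \o (@ract _ _ E ^~ s))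
  ((fun z => tprod (@ract _ _ E) *%R z (coact s)) \o ext_coact)).
- exact: lin_comp.
- by apply: lin_comp => //; exact: tprod_linl.
move=> v t /=; have lv := epure_linr v.
rewrite -/(epure v t) ext_coactE.
have -> : ext_ract (epure v t) s = epure v (t * s) by exact: ext_ractE.
rewrite ext_coactE coactM; move: (coact t) (coact s) => x y.
move: x; apply: (@tensor_ext _ _ _ _ _ _ _
  (tmap (epure v) id \o (fun z => tmul z y))
  ((fun z => tprod (@ract _ _ E) *%R z y) \o tmap (epure v) id)).
- apply: lin_comp; first exact: tmap_linear.
  by apply: tprod_linl => c; first [exact: mul_linl|exact: mul_linr].
- by apply: lin_comp; [exact: tprod_linl|exact: tmap_linear].
move=> a h /=; rewrite /tmul tprod_purel;
  try by move=> ?; first [exact: mul_linl|exact: mul_linr].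
rewrite tmapE// tprod_purel// tmap_comp//; try first [exact: mul_linr|exact: mr].
rewrite /tmap /tlift /tsum; apply: eq_bigr => p _ /=; congr (_ ⊗ _).
by symmetry; exact: ext_ractE.
Qed.

Definition ext_coact_lin : {linear E -> E ⨂ H} :=
  HB.pack ext_coact (GRing.isLinear.Build _ _ _ _ ext_coact ext_coact_linear).

Definition ext_hopf_module : hopf_module S :=
  @HopfModule k H S E ext_coact_lin ext_coactP ext_coactM.

End ExtHopf.
End HopfGalois.

Section FreeModule.
Variables (k : comNzRingType) (R : algType k) (n : nat).

(* The right R-module [R^n]. *)
Definition free_ract (v : {ffun 'I_n -> R}) (r : R) : {ffun 'I_n -> R} :=
  [ffun i => v i * r].

Lemma free_ract_linl r : linear (free_ract^~ r).
Proof. by move=> c u v; apply/ffunP => i; rewrite !ffunE mul_linl. Qed.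
Lemma free_ract_linr v : linear (free_ract v).
Proof. by move=> c r s; apply/ffunP => i; rewrite !ffunE mul_linr. Qed.
Lemma free_ract1 v : free_ract v 1 = v.
Proof. by apply/ffunP => i; rewrite !ffunE mulr1. Qed.
Lemma free_ractA v r s : free_ract (free_ract v r) s = free_ract v (r * s).
Proof. by apply/ffunP => i; rewrite !ffunE mulrA. Qed.

Definition free_rmodule : rmodule R :=
  RModule free_ract_linl free_ract_linr free_ract1 free_ractA.

End FreeModule.

Section Cohomology.
Variables (k : comNzRingType) (H : hopfAlgType k) (S : comodAlgType H).
Variable M : hopf_module S.

Local Notation dM := (hmod_coact M : M -> M ⨂ H).
Local Notation muH := (@mul_map k H).

(* The product of [Hom_k(M, M ⊗ A)], for [A] the n-th tensor power of [H] with
   multiplication [muA]; [muA] is [muH] for n = 1 and [muH ⊗ muH] after the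
   shuffle [chi2] for n = 2. *)
Definition odot (A : lmodType k) (muA : A ⨂ A -> A)
    (phi phi' : M -> M ⨂ A) : M -> M ⨂ A :=
  tmap id muA \o @tassoc _ _ _ _ \o tmap phi id \o phi'.

(* [chi2 ((a1 ⊗ a2) ⊗ (b1 ⊗ b2)) = (a1 ⊗ b1) ⊗ (a2 ⊗ b2)] *)
Definition chi2 : (H ⨂ H) ⨂ (H ⨂ H) -> (H ⨂ H) ⨂ (H ⨂ H) :=
  tlift (tprod (fun a1 b1 => a1 ⊗ b1) (fun a2 b2 => a2 ⊗ b2)).

Definition odot1 := odot muH.
Definition odot2 := odot (tmap muH muH \o chi2).

(* [di_j] is the coface map [d^i] from degree j to degree j + 1.  Iterated
   tensor products [M ⊗ H ⊗ H] are bracketed as [M ⨂ (H ⨂ H)]. *)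
Definition d0_0 (phi : M -> M) : M -> M ⨂ H :=
  tmap id muH \o @tassoc _ _ _ _ \o tmap dM id
    \o tmap phi hantipode \o dM.
Definition d1_0 (phi : M -> M) : M -> M ⨂ H := fun m => phi m ⊗ 1.

Definition d0_1 (Phi : M -> M ⨂ H) : M -> M ⨂ (H ⨂ H) :=
  tmap id (tmap muH id) \o tmap id (@tassoc_inv _ _ _ _)
    \o @tassoc _ _ _ _ \o tmap dM (@tflip _ _ _) \o @tassoc _ _ _ _
    \o tmap Phi hantipode \o dM.
Definition d1_1 (Phi : M -> M ⨂ H) : M -> M ⨂ (H ⨂ H) :=
  tmap id hcomul \o Phi.
Definition d2_1 (Phi : M -> M ⨂ H) : M -> M ⨂ (H ⨂ H) :=
  fun m => tassoc (Phi m ⊗ 1).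

Definition Z1 : set (M -> M ⨂ H) := [set Phi |
  [/\ linear Phi,
      forall m s, Phi (ract m s) = tmap (@ract _ _ M ^~ s) id (Phi m),
      forall m, trunit (tmap id hcounit (Phi m)) = m
    & odot2 (d2_1 Phi) (d0_1 Phi) = d1_1 Phi]]%classic.

Record raut := RAut {
  raut_fun :> M -> M;
  raut_inv : M -> M;
  raut_rlinear : rlinear raut_fun;
  raut_funK : cancel raut_fun raut_inv;
  raut_invK : cancel raut_inv raut_fun }.

Definition Z1_act (Phi : M -> M ⨂ H) (f : raut) : M -> M ⨂ H :=
  odot1 (odot1 (d1_0 (raut_inv f)) Phi) (d0_0 f).

Definition Z1_orbit (Phi : M -> M ⨂ H) : set (M -> M ⨂ H) :=
  [set Z1_act Phi f | f in [set: raut]]%classic.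

Definition H1 : set (set (M -> M ⨂ H)) := [set Z1_orbit Phi | Phi in Z1]%classic.

Definition H1_point : set (M -> M ⨂ H) := Z1_orbit (fun m => m ⊗ 1).

End Cohomology.

Arguments H1 {k H S} M.
Arguments H1_point {k H S} M.

Definition division_algebra (k : comNzRingType) (A : algType k) : Prop :=
  forall x : A, x != 0 -> exists y : A, x * y = 1 /\ y * x = 1.

Section FinGenProj.
Variables (k : comNzRingType) (P : lmodType k).

Definition finitely_generated : Prop :=
  exists (n : nat) (e : 'I_n -> P),
    forall x, exists c : 'I_n -> k, x = \sum_i c i *: e i.

Definition projective : Prop :=
  forall (A B : lmodType k) (g : {linear A -> B}) (f : {linear P -> B}),
    (forall b, exists a, g a = b) ->
    exists h : {linear P -> A}, forall x, g (h x) = f x.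

End FinGenProj.

(* Main.v *)
From HB Require Import structures.
Require Import Defs.
From mathcomp Require Import all_boot all_order all_algebra.
From mathcomp Require Import boolp classical_sets.

Set Implicit Arguments.
Unset Strict Implicit.
Unset Printing Implicit Defensive.

Import GRing.Theory.
Local Open Scope ring_scope.
Local Open Scope tensor_scope.

(** Write [m0 ⊗ m1] for the coaction of a Hopf module M. A map
    Phi : M -> M ⊗ H is traded for its twist D(m) = Phi(m0) m1; the antipode
    gives the inverse trade Phi(m) = D(m0) σ(m1) ([twistK], [untwistK]). In
    terms of D everything becomes transparent. The action of an automorphism f
    is conjugation, D |-> (f^-1 ⊗ id) D f ([twist_Z1_act]); the distinguished
    point corresponds to the given coaction of M; and if Phi is a cocycle, then
    D is another coaction making the same S-module a Hopf module
    ([twist_coaction], [twist_ract]), the cocycle identity being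
    coassociativity. So H^1(H, M) is trivial as soon as each of these Hopf
    module structures is isomorphic to the given one.

    Two Hopf modules over a division algebra are isomorphic when they have
    bases of the same size made of coinvariant vectors ([change_basis_coact]).
    The module L^n has such a basis for its own coaction ([std_is_basis],
    [std_coact]). For the twisted coaction D, the Galois hypothesis enters:
    the coinvariants of any Hopf module span it over S ([hopf_descent]). Then a
    given basis is turned into a basis of coinvariant vectors by exchanging its
    members one at a time ([basis_of_spanning]): if every coinvariant vector
    had l-th coordinate zero, so would every vector, whereas the l-th basis
    vector has l-th coordinate one.

    Descent goes as follows. With R the coinvariants of S, the canonical map
    M ⊗_R S -> M ⊗ H, m ⊗ s |-> m s0 ⊗ s1, is bijective for every S-module
    because it is for S ([can_map_bijective]). Let x in M ⊗_R S be the
    preimage of m0 ⊗ m1. Coassociativity says that the two maps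
    M -> M ⊗ H whose equalizer is the module N of coinvariants agree on x after
    tensoring with S, so by flatness x comes from N ⊗_R S; and x is sent to m
    by the action map, whence m lies in N S. *)

(** * Sweedler sums *)

(** The Sweedler notation: the sum of F(a, h) over the pure tensors a ⊗ h of
    some decomposition of x. Since it is a sum over a chosen decomposition, it
    commutes with linear maps and with other such sums whatever F is; that F be
    balanced only matters when x is replaced by another expression. *)
Notation "\Sw_ ( a , h <- x ) F" := (tlift (fun a h => F) x)
  (at level 41, F at level 41, a, h at level 10, x at level 39,
   format "'[' \Sw_ ( a ,  h  <-  x ) '/  '  F ']'") : tensor_scope.

Local Notation kbilinear F :=
  (balanced (fun a c => c *: a) (fun c b => c *: b) F).

Section SweedlerSums.
Variable k : comNzRingType.

Section Over.
Variables (A B : lmodType k) (R : Type) (ra : A -> R -> A) (la : R -> B -> B).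
Implicit Types (P Q : lmodType k) (x : tensor_over ra la).

Lemma eq_sw P (F G : A -> B -> P) x : (forall a b, F a b = G a b) ->
  \Sw_(a, b <- x) F a b = \Sw_(a, b <- x) G a b.
Proof. by move=> e; apply: eq_bigr => p _; apply: e. Qed.

Lemma sw_push P Q (f : P -> Q) (F : A -> B -> P) x : linear f ->
  f (\Sw_(a, b <- x) F a b) = \Sw_(a, b <- x) f (F a b).
Proof. exact: lin_sum. Qed.

Lemma sw_const_lin P Q (F : Q -> A -> B -> P) x :
  (forall a b, linear (fun q => F q a b)) ->
  linear (fun q => \Sw_(a, b <- x) F q a b).
Proof.
move=> lF c p q; rewrite /tlift /tsum scaler_sumr -big_split.
by apply: eq_bigr => i _; rewrite lF.
Qed.

Lemma sw_lin P Q (X : Q -> tensor_over ra la) (F : A -> B -> P) :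
  linear X -> balanced ra la F -> linear (fun q => \Sw_(a, b <- X q) F a b).
Proof. by move=> lX bF c p q; rewrite lX tlift_linear. Qed.

Lemma sw_pure P (F : A -> B -> P) a b : balanced ra la F ->
  \Sw_(a, b <- tpure a b : tensor_over ra la) F a b = F a b.
Proof. exact: tlift_pure. Qed.

Lemma sw_id x : \Sw_(a, b <- x) tpure a b = x.
Proof. by rewrite [RHS]tensor_sum. Qed.

Lemma sw_exch P (C D : lmodType k) (R' : Type) (ra' : C -> R' -> C) (la' : R' -> D -> D)
    (F : A -> B -> C -> D -> P) x (y : tensor_over ra' la') :
  \Sw_(a, b <- x) \Sw_(c, d <- y) F a b c d
  = \Sw_(c, d <- y) \Sw_(a, b <- x) F a b c d.
Proof. exact: exchange_big. Qed.

Lemma sw_sw P (C D : lmodType k) (R' : Type) (ra' : C -> R' -> C) (la' : R' -> D -> D)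
    (F : A -> B -> P) (G : C -> D -> tensor_over ra la)
    (y : tensor_over ra' la') : balanced ra la F ->
  \Sw_(a, b <- \Sw_(c, d <- y) G c d) F a b
  = \Sw_(c, d <- y) \Sw_(a, b <- G c d) F a b.
Proof. by move=> bF; apply: lin_sum (tlift_linear bF). Qed.

End Over.
End SweedlerSums.

Section Linearity.
Variable k : comNzRingType.
Implicit Types (P A B C : lmodType k) (R : Type).

Record trilinear (A B C P : lmodType k) (T : A -> B -> C -> P) : Prop :=
  Trilinear { tri1 : forall b c, linear (fun a => T a b c);
    tri2 : forall a c, linear (fun b => T a b c);
    tri3 : forall a b, linear (T a b) }.

Lemma lin_app P A B (f : A -> B) (F : P -> A) :
  linear f -> linear F -> linear (fun x => f (F x)).
Proof. exact: lin_comp. Qed.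

Lemma lin_balL P A B C ra la (f : A -> B -> C) (F : P -> A) b :
  @balanced k A B k ra la C f -> linear F -> linear (fun x => f (F x) b).
Proof. by move=> bf; apply: lin_comp (bal_linl bf b). Qed.

Lemma lin_balR P A B C ra la (f : A -> B -> C) a (F : P -> B) :
  @balanced k A B k ra la C f -> linear F -> linear (fun x => f a (F x)).
Proof. by move=> bf; apply: lin_comp (bal_linr bf a). Qed.

Lemma lin_lin P A B (f : {linear A -> B}) (F : P -> A) :
  linear F -> linear (fun x => f (F x)).
Proof. by apply: lin_app; exact: linearP. Qed.

Lemma lin_pureL P A B R ra la (F : P -> A) (b : B) : linear F ->
  linear (fun x => tpure (F x) b : @tensor_over k A B R ra la).
Proof. by move=> lF; apply: lin_comp (bal_linl (tpure_balanced ra la) b) lF. Qed.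

Lemma lin_pureR P A B R ra la (a : A) (F : P -> B) : linear F ->
  linear (fun x => tpure a (F x) : @tensor_over k A B R ra la).
Proof. by move=> lF; apply: lin_comp (bal_linr (tpure_balanced ra la) a) lF. Qed.

Lemma lin_mulL P (C : algType k) (F : P -> C) c :
  linear F -> linear (fun x => F x * c).
Proof. exact: lin_comp (mul_linl c). Qed.

Lemma lin_mulR P (C : algType k) (F : P -> C) c :
  linear F -> linear (fun x => c * F x).
Proof. exact: lin_comp (mul_linr c). Qed.

Lemma lin_ractL P (S : algType k) (M : rmodule S) (F : P -> M) s :
  linear F -> linear (fun x => ract (F x) s).
Proof. exact: lin_comp (ract_linl s). Qed.

Lemma lin_ractR P (S : algType k) (M : rmodule S) (F : P -> S) m :
  linear F -> linear (fun x => ract (m : M) (F x)).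
Proof. exact: lin_comp (ract_linr m). Qed.

Lemma lin_scaleL P A (F : P -> k^o) (a : A) :
  linear F -> linear (fun x => (F x : k) *: a).
Proof. by move=> lF c x y; rewrite lF scalerDl scalerA. Qed.

Lemma lin_scaleR P A (F : P -> A) (c : k) :
  linear F -> linear (fun x => c *: F x).
Proof. by move=> lF d x y; rewrite lF scalerDr !scalerA mulrC. Qed.
End Linearity.

(** [lin] proves linearity, bilinearity or trilinearity of a nested Sweedler
    expression by following its syntax: the variable occurs exactly once, and
    each lemma above peels off the outermost operation around it. *)
Ltac lin_step := cbv beta;
  first
  [ match goal with h : _ |- _ => apply h end
  | lazymatch goal with
    | |- balanced _ _ _ => eapply balancedP; intros
    | |- trilinear _ => eapply Trilinear; intros
    | |- GRing.linear_for _ (fun x => x) => exact (@lin_id _ _)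
    | |- GRing.linear_for _ (fun x => tpure _ _) =>
        first [eapply lin_pureL | eapply lin_pureR]
    | |- GRing.linear_for _ (fun x => tlift _ _) =>
        first [eapply sw_const_lin; intros | eapply sw_lin]
    | |- GRing.linear_for _ (fun x => _ * _) =>
        first [eapply lin_mulL | eapply lin_mulR]
    | |- GRing.linear_for _ (fun x => _ *: _) =>
        first [eapply lin_scaleL | eapply lin_scaleR]
    | |- GRing.linear_for _ (fun x => ract _ _) =>
        first [eapply lin_ractL | eapply lin_ractR]
    end
  | exact (mul_linr _) | exact (pure_linr _) | exact (ract_linr _)
  | exact (lin_scaleR _ (@lin_id _ _))
  | eapply tlift_linear | eapply lin_lin
  | match goal with h : linear ?f |- _ => eapply (lin_app h) end
  | match goal with h : balanced _ _ _ |- _ =>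
      first [eapply (lin_balL _ h) | eapply (lin_balR _ h)] end ].
Ltac lin := intros; repeat lin_step.

(** Rewriting with a Sweedler identity whose side conditions are linearity
    statements. *)
Ltac rws lem := rewrite lem; [|by lin..].

(** * Hopf algebra identities in Sweedler form *)

Section Coalgebra.
Variables (k : comNzRingType) (H : hopfAlgType k).

Lemma sw_tmap (A B C D P : lmodType k) (f : A -> C) (g : B -> D)
    (F : C -> D -> P) x :
  kbilinear F ->
  \Sw_(c, d <- tmap f g x) F c d = \Sw_(a, b <- x) F (f a) (g b).
Proof.
by move=> bF; rws @sw_sw; apply: eq_sw => a b; rws @sw_pure.
Qed.

Lemma sw_tassoc (A B C P : lmodType k) (F : A -> B ⨂ C -> P)
    (x : (A ⨂ B) ⨂ C) :
  kbilinear F ->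
  \Sw_(a, z <- tassoc x) F a z
  = \Sw_(ab, c <- x) \Sw_(a, b <- ab) F a (b ⊗ c).
Proof.
move=> bF; rws @sw_sw; apply: eq_sw => ab c; rws @sw_sw.
by apply: eq_sw => a b; rws @sw_pure.
Qed.

(** Coassociativity in the form in which it is used: in any trilinear
    expression, m00, m01, m1 may be renamed m0, m1, m2. *)
Lemma coassoc_sw (M P : lmodType k) (d : M -> M ⨂ H) (T : M -> H -> H -> P) m :
  is_coaction d -> linear d -> trilinear T ->
  \Sw_(a, h <- d m) \Sw_(b, l <- d a) T b l h
  = \Sw_(a, h <- d m) \Sw_(h1, h2 <- hcomul h) T a h1 h2.
Proof.
move=> [dA _] ld [l1 l2 l3].
have := congr1 (tlift (fun a z => \Sw_(h1, h2 <- z) T a h1 h2)) (dA m).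
rws @sw_tassoc; rws @sw_tmap; rws @sw_tmap => <-.
apply: eq_sw => a h; apply: eq_sw => b l; by rws @sw_pure.
Qed.

Lemma trunit_sw (M : lmodType k) (x : M ⨂ H) :
  trunit (tmap id hcounit x) = \Sw_(a, h <- x) (hcounit h : k) *: a.
Proof.
rewrite /trunit.
have lh : linear (@hcounit k H) by exact: linearP.
rewrite (@sw_tmap M H M k^o M id hcounit (fun a c => (c : k) *: a)) //.
exact: trunit_bal.
Qed.

Lemma counit_sw (M : lmodType k) (d : M -> M ⨂ H) m : is_coaction d ->
  \Sw_(a, h <- d m) (hcounit h : k) *: a = m.
Proof. by move=> [_ dc]; rewrite -[RHS]dc trunit_sw. Qed.

Lemma hcomul_coaction : is_coaction (@hcomul k H).
Proof. by split; [exact: hcomulA | exact: hcounitr]. Qed.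

Lemma hcounit_sw h : \Sw_(h1, h2 <- hcomul h) (hcounit h1 : k) *: h2 = h :> H.
Proof.
rewrite -[RHS]hcounitl /tlunit.
have b : balanced (fun (a : k^o) (c : k) => c *: a) (fun c (b : H) => c *: b)
  (fun (c : k^o) (a : H) => (c : k) *: a) by lin.
have lh : linear (@hcounit k H) by exact: linearP.
by rewrite (@sw_tmap H H k^o H H hcounit id _ _ b).
Qed.
Lemma mul_mapE (x : H ⨂ H) : mul_map x = \Sw_(a, b <- x) a * b.
Proof. by []. Qed.

Lemma antipodel_sw h : \Sw_(h1, h2 <- hcomul h) hantipode h1 * h2
  = (hcounit h : k) *: 1 :> H.
Proof. by rewrite -hantipodel mul_mapE; rws @sw_tmap. Qed.

Lemma antipoder_sw h : \Sw_(h1, h2 <- hcomul h) h1 * hantipode h2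
  = (hcounit h : k) *: 1 :> H.
Proof. by rewrite -hantipoder mul_mapE; rws @sw_tmap. Qed.

Lemma tprod_sw (A B C A' B' C' P : lmodType k) (f : A -> B -> C)
    (g : A' -> B' -> C') (F : C -> C' -> P) x y :
  kbilinear F ->
  \Sw_(c, c' <- tprod f g x y) F c c'
  = \Sw_(a, a' <- x) \Sw_(b, b' <- y) F (f a b) (g a' b').
Proof.
move=> bF; rewrite [tprod f g x y]/tprod; rws @sw_sw.
by apply: eq_sw => a a'; rws @sw_tmap.
Qed.

Lemma hcomulM_sw (P : lmodType k) (F : H -> H -> P) g h :
  kbilinear F ->
  \Sw_(l, l' <- hcomul (g * h)) F l l'
  = \Sw_(g1, g2 <- hcomul g) \Sw_(h1, h2 <- hcomul h) F (g1 * h1) (g2 * h2).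
Proof. by move=> bF; rewrite hcomulM; rws @tprod_sw. Qed.

End Coalgebra.

(** * Twisting by the coaction *)

Section Twist.
Variables (k : comNzRingType) (H : hopfAlgType k) (M : lmodType k).
Variable d : M -> M ⨂ H.
Hypotheses (dP : is_coaction d) (ld : linear d).
Implicit Types (Phi : M -> M ⨂ H) (g : H -> H).

(** [twist id Phi] is m |-> Phi(m0) m1, the product Phi ⊙ d; with the antipode
    for g it undoes this, being a convolution with the inverse of [id]. *)
Definition twist g Phi m : M ⨂ H :=
  \Sw_(a, h <- d m) \Sw_(b, l <- Phi a) b ⊗ (l * g h).

Lemma twist_linear g Phi : linear g -> linear Phi -> linear (twist g Phi).
Proof. by move=> lg lP; rewrite /twist; lin. Qed.

(** Twists compose by convolution of g' and g; here the convolution is the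
    convolution unit, h |-> ε(h) 1. *)
Lemma twist_twist g g' Phi m : linear g -> linear g' -> linear Phi ->
  (forall h, \Sw_(h1, h2 <- hcomul h) g' h1 * g h2 = (hcounit h : k) *: 1) ->
  twist g (twist g' Phi) m = Phi m.
Proof.
move=> lg lg' lP gg'.
have -> : twist g (twist g' Phi) m = \Sw_(a, h <- d m) \Sw_(b, l <- d a)
    \Sw_(c, l' <- Phi b) c ⊗ (l' * g' l * g h).
  apply: eq_sw => a h; rewrite /twist; rws @sw_sw; apply: eq_sw => b l.
  by rws @sw_sw; apply: eq_sw => c l'; rws @sw_pure.
rewrite (coassoc_sw (T := fun b l h => \Sw_(c, l' <- Phi b) c ⊗ (l' * g' l * g h)));
  [|by lin..].
rewrite -[in RHS](counit_sw m dP) sw_push //; apply: eq_sw => a h.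
rewrite sw_exch (lin_scale _ _ lP) -[in RHS](sw_id (Phi a)) sw_push; last by lin.
apply: eq_sw => c l'.
under eq_sw do rewrite -mulrA.
rewrite -(sw_push (f := fun x => c ⊗ (l' * x))); last by lin.
by rewrite gg' -scalerAr mulr1 (lin_scale _ _ (pure_linr c)).
Qed.

Lemma twistK Phi m : linear Phi -> twist hantipode (twist id Phi) m = Phi m.
Proof.
by move=> lP; apply: twist_twist => // [|h]; [exact: linearP|exact: antipoder_sw].
Qed.

Lemma untwistK Phi m : linear Phi -> twist id (twist hantipode Phi) m = Phi m.
Proof.
by move=> lP; apply: twist_twist => // [|h]; [exact: linearP|exact: antipodel_sw].
Qed.

Lemma twist_point m : twist id (fun a => a ⊗ 1) m = d m.
Proof.
rewrite -[RHS]sw_id; apply: eq_sw => a h.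
by rws @sw_pure; rewrite mul1r.
Qed.

End Twist.

(** * The cosimplicial operations in Sweedler form *)

Section Cochains.
Variables (k : comNzRingType) (H : hopfAlgType k) (S : comodAlgType H).

Lemma mul_map_linear : linear (@mul_map k H).
Proof. by apply: tlift_linear; lin. Qed.

(** The scalar multiplication of a module is the action of the scalars of the
    algebra, so linearity over the algebra contains linearity over k. *)
Lemma rlinear_linear (R : algType k) (M N : rmodule R) (f : M -> N) :
  rlinear f -> linear f.
Proof.
move=> [fD fr] c x y; rewrite fD; congr (_ + _).
have sc (P : rmodule R) (p : P) : c *: p = ract p (c *: 1).
  by rewrite (lin_scale _ _ (ract_linr p)) ract1.
by rewrite !sc fr.
Qed.

Variable M : hopf_module S.
Local Notation dM := (hmod_coact M).

Lemma hmod_coact_linear : linear dM. Proof. exact: linearP. Qed.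

Lemma odot_sw (A : lmodType k) (muA : A ⨂ A -> A) (phi phi' : M -> M ⨂ A) m :
  linear muA -> linear phi -> odot muA phi phi' m
  = \Sw_(a, h <- phi' m) \Sw_(b, l <- phi a) b ⊗ muA (l ⊗ h).
Proof.
move=> lmu lphi; rewrite /odot /= [LHS]/tmap.
by rws @sw_tassoc; rws @sw_tmap.
Qed.

Lemma odot1_sw (phi phi' : M -> M ⨂ H) m : linear phi -> odot1 phi phi' m
  = \Sw_(a, h <- phi' m) \Sw_(b, l <- phi a) b ⊗ (l * h).
Proof.
move=> lphi; rewrite /odot1 odot_sw //; last exact: mul_map_linear.
by apply: eq_sw => a h; apply: eq_sw => b l; rewrite mul_mapE; rws @sw_pure.
Qed.

Lemma d0_0_sw (phi : M -> M) m :
  d0_0 phi m = twist dM hantipode (dM \o phi) m.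
Proof.
rewrite /d0_0 /= [LHS]/tmap.
have lmu := mul_map_linear; have ld := hmod_coact_linear.
rws @sw_tassoc; rws @sw_tmap; rws @sw_tmap.
by apply: eq_sw => a h; apply: eq_sw => b l; rewrite mul_mapE; rws @sw_pure.
Qed.

Lemma raut_inv_linear (f : raut M) : linear (raut_inv f).
Proof.
have lf := rlinear_linear (raut_rlinear f).
move=> c x y; rewrite -{1}(raut_invK f x) -{1}(raut_invK f y) -lf.
exact: raut_funK.
Qed.

(** The cocycle Phi ↼ f is untwisted from the conjugate by f of the twist of
    Phi: the factor m1 of the twist appears because d^0 f puts the coaction on
    both sides of f. *)
Lemma Z1_act_twist Phi (f : raut M) m : linear Phi ->
  Z1_act Phi f m = twist dM hantipode
    (fun a => tmap (raut_inv f) id (twist dM id Phi (f a))) m.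
Proof.
move=> lP; have lf := rlinear_linear (raut_rlinear f).
have lf' := raut_inv_linear f; have ld := hmod_coact_linear.
have ld1 : linear (d1_0 (raut_inv f) : M -> M ⨂ H) by rewrite /d1_0; lin.
have lt : linear (tmap (raut_inv f) (@id H)) by apply: tmap_linear => //; exact: lin_id.
have E : odot1 (d1_0 (raut_inv f)) Phi = tmap (raut_inv f) id \o Phi.
  apply/funext => b; rewrite odot1_sw //; apply: eq_sw => a h.
  by rewrite /d1_0; rws @sw_pure; rewrite mul1r.
rewrite /Z1_act E odot1_sw; last exact: lin_comp.
rewrite d0_0_sw /twist; rws @sw_sw.
apply: eq_sw => a h; rws @sw_sw; rws @sw_tmap; rws @sw_sw.
apply: eq_sw => b l; rws @sw_pure; rws @sw_tmap; rws @sw_sw.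
by apply: eq_sw => c l'; rws @sw_pure; rewrite mulrA.
Qed.
End Cochains.

Section Cocycles.
Variables (k : comNzRingType) (H : hopfAlgType k) (S : comodAlgType H).
Variable M : hopf_module S.
Local Notation dM := (hmod_coact M).
Local Notation tw Phi := (twist dM id Phi).

Lemma chi2_linear : linear (@chi2 k H).
Proof.
apply: tlift_linear; apply: balancedP => [y|x]; first by apply: tprod_linl; lin.
by apply: tprod_linr; lin.
Qed.

Lemma mul2_pure (a a' b b' : H) :
  tmap (@mul_map k H) (@mul_map k H) (chi2 ((a ⊗ a') ⊗ (b ⊗ b')))
  = (a * b) ⊗ (a' * b').
Proof.
have lmu := @mul_map_linear k H.
have mu (x y : H) : mul_map (x ⊗ y) = x * y.
  by rewrite mul_mapE; rws @sw_pure.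
rewrite /chi2 sw_pure; last first.
  by apply: balancedP => [y|x]; [apply: tprod_linl|apply: tprod_linr]; lin.
rewrite [X in tmap _ _ X](_ : _ = (a ⊗ b) ⊗ (a' ⊗ b')); last by apply: tprodE; lin.
by rewrite tmapE ?mu.
Qed.

Lemma d2_1_sw (Phi : M -> M ⨂ H) m :
  d2_1 Phi m = \Sw_(a, l <- Phi m) a ⊗ (l ⊗ 1).
Proof. by rewrite /d2_1 -[LHS]sw_id; rws @sw_tassoc; rws @sw_pure. Qed.

Lemma d0_1_sw (Phi : M -> M ⨂ H) m : d0_1 Phi m
  = \Sw_(a, h <- dM m) \Sw_(b, l <- Phi a) \Sw_(c, l' <- dM b)
      c ⊗ ((l' * hantipode h) ⊗ l).
Proof.
have ld := @hmod_coact_linear _ _ _ M; have lmu := @mul_map_linear k H.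
have lmi : linear (tmap (@mul_map k H) (@id H)) by apply: tmap_linear.
have ltm : linear (@tassoc_inv k H H H) by apply: tlift_linear; lin.
have ltf : linear (@tflip k H H) by apply: tlift_linear; lin.
rewrite /d0_1 /= [LHS]/tmap; rws @sw_tmap.
rws @sw_tassoc; rws @sw_tmap; rws @sw_tassoc; rws @sw_tmap.
apply: eq_sw => a h; apply: eq_sw => b l; apply: eq_sw => c l'.
rewrite /tflip sw_pure; last by lin.
rewrite /tassoc_inv sw_pure; last by lin.
by rws @sw_pure; rewrite tmapE // mul_mapE; rws @sw_pure.
Qed.

(** The left-hand side of the cocycle identity only sees one of its two copies
    of Phi through its twist. *)
Lemma odot2_sw (Phi : M -> M ⨂ H) m : linear Phi ->
  odot2 (d2_1 Phi) (d0_1 Phi) m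
  = \Sw_(a, h <- dM m) \Sw_(b, l <- Phi a) \Sw_(c, l' <- tw Phi b)
      c ⊗ ((l' * hantipode h) ⊗ l).
Proof.
move=> lP; have ld := @hmod_coact_linear _ _ _ M.
have lmu : linear (tmap (@mul_map k H) (@mul_map k H) \o @chi2 k H).
  apply: lin_comp; last exact: chi2_linear.
  by apply: tmap_linear; exact: mul_map_linear.
have l2 : linear (d2_1 Phi).
  have l' : linear (fun m => \Sw_(a, l <- Phi m) a ⊗ (l ⊗ (1 : H))) by lin.
  by move=> c x y; rewrite !d2_1_sw l'.
rewrite /odot2 odot_sw // d0_1_sw; rws @sw_sw.
apply: eq_sw => a h; rws @sw_sw; apply: eq_sw => b l.
rewrite /twist; rws @sw_sw; rws @sw_sw; apply: eq_sw => c l'.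
rws @sw_pure; rewrite d2_1_sw; rws @sw_sw; rws @sw_sw; apply: eq_sw => e h'.
by do 2 rws @sw_pure; rewrite /= mul2_pure mulrA mul1r.
Qed.
End Cocycles.

(** * Cocycles give Hopf module structures *)

Section TwistedHopfModule.
Variables (k : comNzRingType) (H : hopfAlgType k) (S : comodAlgType H).
Variable M : hopf_module S.
Local Notation dM := (hmod_coact M).
Local Notation tw Phi := (twist dM id Phi).

(** The identity l σ(h1) h2 ⊗ h3 = l ⊗ h, inside a bilinear expression. *)
Lemma antipode_cancel (P : lmodType k) (F : H -> H -> P) l h :
  kbilinear F ->
  \Sw_(h1, h2 <- hcomul h) \Sw_(h3, h4 <- hcomul h2) F (l * hantipode h1 * h3) h4
  = F l h.
Proof.
move=> bF; have [F1 F2 _] := bF; have lh : linear (@hcomul k H) by exact: linearP.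
rewrite -(coassoc_sw (T := fun a b c => F (l * hantipode a * b) c));
  [|exact: hcomul_coaction|by lin..].
rewrite -[in RHS](hcounit_sw h) sw_push //; apply: eq_sw => h1 h2.
under eq_sw do rewrite -mulrA.
rewrite -(sw_push (f := fun x => F (l * x) h2)); last by lin.
by rewrite antipodel_sw -scalerAr mulr1 (lin_scale _ _ (F1 h2)) (lin_scale _ _ (F2 l)).
Qed.

Section Cocycle.
Variable Phi : M -> M ⨂ H.
Hypothesis PhiZ : Z1 Phi.

(** The cocycle identity at m0, multiplied on the right by the coproduct of m1,
    is the coassociativity of the twist at m: the antipode that it contains is
    cancelled by the first leg of that coproduct. *)
Lemma twist_coaction : is_coaction (tw Phi).
Proof.
have [lP Pr Pc C] := PhiZ; have ld := @hmod_coact_linear _ _ _ M.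
have ltw : linear (tw Phi) by exact: (twist_linear ld (@lin_id _ _)).
have lh : linear (@hcomul k H) by exact: linearP.
split=> m; last first.
  rewrite trunit_sw -[in RHS](counit_sw m (hmod_coactP M)) /twist sw_sw; last by lin.
  apply: eq_sw => a h; rewrite -{2}(Pc a) trunit_sw.
  rewrite [in RHS]sw_push; last by lin.
  rws @sw_sw; apply: eq_sw => b l; rws @sw_pure.
  by rewrite hcounitM scalerA mulrC.
transitivity (\Sw_(a, h <- dM m) \Sw_(b, l <- Phi a) \Sw_(d, l' <- tw Phi b)
    d ⊗ (l' ⊗ (l * h))).
  rewrite -[LHS]sw_id; rws @sw_tassoc; rws @sw_tmap; rewrite {1}/twist; rws @sw_sw.
  by apply: eq_sw => a h; rws @sw_sw; apply: eq_sw => b l; rws @sw_pure.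
(* Insert σ(h') h1, which coassociativity and the antipode cancel. *)
transitivity (\Sw_(a, h <- dM m) \Sw_(a', h' <- dM a) \Sw_(b, l <- Phi a')
    \Sw_(c, l' <- tw Phi b) \Sw_(h1, h2 <- hcomul h)
    c ⊗ ((l' * hantipode h' * h1) ⊗ (l * h2))).
  rewrite (coassoc_sw (T := fun a h' h => \Sw_(b, l <- Phi a)
    \Sw_(c, l' <- tw Phi b) \Sw_(h1, h2 <- hcomul h)
    c ⊗ ((l' * hantipode h' * h1) ⊗ (l * h2)))) //; [|exact: hmod_coactP|by lin..].
  apply: eq_sw => a h; rewrite sw_exch; apply: eq_sw => b l.
  rewrite sw_exch; apply: eq_sw => c l'.
  by rewrite (antipode_cancel (F := fun x y => c ⊗ (x ⊗ (l * y)))) //; lin.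
rewrite -[RHS]sw_id; rws @sw_tmap; rewrite [in RHS]/twist; rws @sw_sw.
apply: eq_sw => a h; rws @sw_sw.
(* The cocycle identity at a, multiplied on the right by the coproduct of h. *)
have := congr1 (tlift (fun b z => \Sw_(l1, l2 <- z) \Sw_(h1, h2 <- hcomul h)
  b ⊗ ((l1 * h1) ⊗ (l2 * h2)))) (congr1 (@^~ a) C).
rewrite odot2_sw // /d1_1; rws @sw_tmap; rws @sw_sw => E.
transitivity (\Sw_(a0, b <- Phi a) \Sw_(l1, l2 <- hcomul b)
   \Sw_(h1, h2 <- hcomul h) a0 ⊗ ((l1 * h1) ⊗ (l2 * h2))).
  rewrite -{}E; apply: eq_sw => a' h'; rws @sw_sw; apply: eq_sw => b l.
  rewrite [in RHS]sw_sw; last (by lin); apply: eq_sw => c l'.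
  by do 2 rws @sw_pure.
apply: eq_sw => b l; rws @sw_pure.
rewrite -[X in b ⊗ X]sw_id; rws @hcomulM_sw.
rewrite sw_push; last by lin.
by apply: eq_sw => l1 l2; rewrite sw_push //; lin.
Qed.

Lemma twist_ract m s : tw Phi (ract m s)
  = tprod (@ract _ _ M) *%R (tw Phi m) (coact s).
Proof.
have [lP Pr _ _] := PhiZ; have ld := @hmod_coact_linear _ _ _ M.
rewrite -[RHS]sw_id; rws @tprod_sw; rewrite /twist hmod_coactM; rws @tprod_sw; rws @sw_sw.
apply: eq_sw => a h; rws @sw_sw.
under [RHS]eq_sw => b l do (rewrite sw_pure; last by lin).
rewrite [RHS]sw_exch; apply: eq_sw => t l; rewrite Pr.
by rws @sw_tmap; apply: eq_sw => b l'; rewrite mulrA.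
Qed.

Lemma twist_cocycle_linear : linear (tw Phi).
Proof.
by have [lP _ _ _] := PhiZ; exact: (twist_linear (@hmod_coact_linear _ _ _ M) (@lin_id _ _)).
Qed.

Definition twisted_coact : {linear M -> M ⨂ H} :=
  HB.pack (tw Phi) (GRing.isLinear.Build _ _ _ _ (tw Phi)
    twist_cocycle_linear).

Definition twisted_module : hopf_module S :=
  @HopfModule k H S M twisted_coact twist_coaction twist_ract.

End Cocycle.

Lemma point_Z1 : Z1 (fun m : M => m ⊗ (1 : H)).
Proof.
have ld := @hmod_coact_linear _ _ _ M.
split.
- exact: pure_linl.
- by move=> m s; rewrite tmapE //; exact: ract_linl.
- move=> m; have lh : linear (@hcounit k H) by exact: linearP.
  by rewrite tmapE // trunitE hcounit1 scale1r.
apply/funext => m; rewrite odot2_sw; last exact: pure_linl.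
rewrite /d1_1 /= tmapE //; last exact: linearP.
rewrite hcomul1 -[in RHS](counit_sw m (hmod_coactP M)).
rewrite (sw_push (f := fun x : M => x ⊗ ((1 : H) ⊗ (1 : H)))); last by lin.
transitivity (\Sw_(a, h <- dM m) \Sw_(b, l <- dM a)
    b ⊗ ((l * hantipode h) ⊗ (1 : H))).
  apply: eq_sw => a h; rewrite sw_pure; last first.
    have := twist_linear ld (@lin_id _ _) (@pure_linl k M H 1).
    by lin.
  by rewrite twist_point.
rewrite (coassoc_sw (T := fun b l h => b ⊗ ((l * hantipode h) ⊗ (1 : H)))) //;
  [|exact: hmod_coactP|by lin..].
apply: eq_sw => a h.
rewrite -(sw_push (f := fun x => a ⊗ (x ⊗ (1 : H)))); last by lin.
rewrite antipoder_sw.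
rewrite (lin_scale (f := fun x => a ⊗ (x ⊗ (1 : H)))); last by lin.
by rewrite (lin_scale (f := fun x => x ⊗ ((1 : H) ⊗ (1 : H)))) //; lin.
Qed.

End TwistedHopfModule.

(** * The action of automorphisms on cocycles *)

Section Action.
Variables (k : comNzRingType) (H : hopfAlgType k) (S : comodAlgType H).
Variable M : hopf_module S.
Local Notation dM := (hmod_coact M).
Local Notation tw Phi := (twist dM id Phi).
Implicit Types (Phi : M -> M ⨂ H) (f g : raut M).

Lemma raut_tmap_linear f : linear (tmap (raut_inv f) (@id H)).
Proof. by apply: tmap_linear; [exact: raut_inv_linear|exact: lin_id]. Qed.

Lemma conj_linear Phi f : linear Phi ->
  linear (fun m => tmap (raut_inv f) id (tw Phi (f m))).
Proof.
move=> lP; apply: (lin_comp (raut_tmap_linear f)).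
apply: (lin_comp (twist_linear (@hmod_coact_linear _ _ _ M) (@lin_id _ _) lP)).
exact: rlinear_linear (raut_rlinear f).
Qed.

Lemma Z1_act_linear Phi f : linear Phi -> linear (Z1_act Phi f).
Proof.
move=> lP c x y; rewrite !Z1_act_twist //; move: c x y.
apply: (twist_linear (@hmod_coact_linear _ _ _ M)); last exact: conj_linear.
exact: linearP.
Qed.

Lemma twist_Z1_act Phi f m : linear Phi ->
  tw (Z1_act Phi f) m = tmap (raut_inv f) id (tw Phi (f m)).
Proof.
move=> lP; have -> : Z1_act Phi f = twist dM hantipode
    (fun a => tmap (raut_inv f) id (tw Phi (f a))).
  by apply/funext => a; exact: Z1_act_twist.
by rewrite untwistK //; [exact: hmod_coactP|exact: hmod_coact_linear|exact: conj_linear].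
Qed.

Lemma twist_inj Phi Phi' : linear Phi -> linear Phi' ->
  tw Phi =1 tw Phi' -> Phi = Phi'.
Proof.
move=> lP lP' e; apply/funext => m.
have ld := @hmod_coact_linear _ _ _ M; have dP := hmod_coactP M.
rewrite -(twistK dP ld m lP) -[RHS](twistK dP ld m lP').
by congr twist; apply/funext.
Qed.

Definition raut_comp f g : raut M.
Proof.
refine (@RAut _ _ _ M (f \o g) (raut_inv g \o raut_inv f) _ _ _).
- have [[fD fr] [gD gr]] := (raut_rlinear f, raut_rlinear g).
  by split=> [x y|m s]; rewrite /= ?gD ?fD ?gr ?fr.
- by move=> x; rewrite /= !raut_funK.
- by move=> x; rewrite /= !raut_invK.
Defined.

Definition raut_sym f : raut M.
Proof.
refine (@RAut _ _ _ M (raut_inv f) f _ (@raut_invK _ _ _ _ f) (@raut_funK _ _ _ _ f)).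
have [fD fr] := raut_rlinear f.
by split=> [x y|m s]; apply: (can_inj (raut_funK f)); rewrite ?fD ?fr !raut_invK.
Defined.

Lemma Z1_actA Phi f g : linear Phi ->
  Z1_act (Z1_act Phi f) g = Z1_act Phi (raut_comp f g).
Proof.
move=> lP; have lPf := Z1_act_linear f lP.
apply: twist_inj => [||m]; [exact: Z1_act_linear..|].
rewrite !twist_Z1_act // tmap_comp //; exact: raut_inv_linear.
Qed.

Lemma Z1_actK Phi f : linear Phi -> Z1_act (Z1_act Phi f) (raut_sym f) = Phi.
Proof.
move=> lP; have lPf := Z1_act_linear f lP.
apply: twist_inj => [||m] //; first exact: Z1_act_linear.
have lf := rlinear_linear (raut_rlinear f); have lf' := raut_inv_linear f.
rewrite !twist_Z1_act //= tmap_comp //=.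
rewrite raut_invK -[RHS]sw_id; apply: eq_sw => a h.
by rewrite /= raut_invK.
Qed.

Lemma Z1_orbit_act Phi f : linear Phi ->
  Z1_orbit (Z1_act Phi f) = Z1_orbit Phi.
Proof.
move=> lP; rewrite /Z1_orbit eqEsubset; split=> [_ [g _ <-]|_ [g _ <-]].
  by exists (raut_comp f g) => //; rewrite Z1_actA.
exists (raut_comp (raut_sym f) g) => //.
by rewrite -Z1_actA ?Z1_actK //; exact: Z1_act_linear.
Qed.

(** The inclusion of the point in H^1 rests on the trivial cochain being a
    cocycle; the other one on all points of an orbit having the same orbit. *)
Lemma H1_trivial :
  (forall Phi, Z1 Phi -> exists f, Z1_act (fun m => m ⊗ (1 : H)) f = Phi) ->
  H1 M = [set H1_point M]%classic.
Proof.
move=> h; rewrite /H1 eqEsubset; split=> [_ [Phi ZPhi <-]|_ ->].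
  by have [f <-] := h _ ZPhi; rewrite /= Z1_orbit_act //; exact: pure_linl.
by exists (fun m => m ⊗ 1) => //; exact: point_Z1.
Qed.

(** An isomorphism of Hopf modules from M to M with the twisted coaction,
    written as the inverse of f, moves the trivial cocycle to Phi: both have
    the same twist. *)
Lemma Z1_act_point Phi f : linear Phi ->
  (forall m, tw Phi (raut_inv f m) = tmap (raut_inv f) id (dM m)) ->
  Z1_act (fun m => m ⊗ (1 : H)) f = Phi.
Proof.
move=> lP e; have l1 : linear (fun m : M => m ⊗ (1 : H)) by exact: pure_linl.
apply: twist_inj => [||m] //; first exact: Z1_act_linear.
rewrite twist_Z1_act // twist_point.
by rewrite -e raut_funK.
Qed.

End Action.

(** * The canonical map of a module over a Galois extension *)

Section Canonical.
Variables (k : comNzRingType) (H : hopfAlgType k) (S : comodAlgType H).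
Local Notation R := (coinv S).
Local Notation psi := (@coinv_incl k H S).

Section Restriction.
Variable P : rmodule S.

Definition res_ract (p : P) (r : R) : P := ract p (psi r).

Lemma res_ract_linl r : linear (res_ract^~ r). Proof. exact: ract_linl. Qed.
Lemma res_ract_linr p : linear (res_ract p).
Proof. by apply: lin_ractR; exact: linearP. Qed.
Lemma res_ract1 p : res_ract p 1 = p.
Proof. by rewrite /res_ract rmorph1 ract1. Qed.
Lemma res_ractA p r r' : res_ract (res_ract p r) r' = res_ract p (r * r').
Proof. by rewrite /res_ract rmorphM ractA. Qed.

Definition res_rmodule : rmodule R :=
  RModule res_ract_linl res_ract_linr res_ract1 res_ractA.

Local Notation bsl f :=
  (balanced (@ract _ _ res_rmodule) (fun r (s : S) => psi r * s) f).

(** The map P ⊗_R S -> P ⊗ H, p ⊗ s |-> p s0 ⊗ s1; for P = S it is the Galois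
    map. *)
Definition can_map (x : ext_tensor psi res_rmodule) : P ⨂ H :=
  \Sw_(p, s <- x) \Sw_(t, h <- coact s) ract (p : P) t ⊗ h.

Lemma coinv_coact_sw (Q : lmodType k) (F : S -> H -> Q) r (s : S) : kbilinear F ->
  \Sw_(t, h <- coact (psi r * s)) F t h = \Sw_(t, h <- coact s) F (psi r * t) h.
Proof.
move=> bF; rewrite coactM coact_coinv; rws @tprod_sw; rws @sw_pure.
by apply: eq_sw => t h; rewrite mul1r.
Qed.

Lemma can_map_bal : bsl (fun p s => \Sw_(t, h <- coact s) ract (p : P) t ⊗ h).
Proof.
have lc : linear (@coact k H S) by exact: linearP.
split=> [s|p|p r s]; [by lin|by lin|].
rws @coinv_coact_sw; apply: eq_sw => t h.
by rewrite /= /res_ract ractA.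
Qed.

Lemma can_map_pure (p : P) s : can_map (tpure p s)
  = \Sw_(t, h <- coact s) ract (p : P) t ⊗ h.
Proof. by rewrite /can_map sw_pure //; exact: can_map_bal. Qed.

Lemma can_map_linear : linear can_map.
Proof. by apply: tlift_linear; exact: can_map_bal. Qed.

End Restriction.

Definition regular_rmodule : rmodule S :=
  @RModule k S S *%R (@mul_linl k S) (@mul_linr k S) (@mulr1 S)
    (fun s t u => esym (mulrA s t u)).
Local Notation reg := regular_rmodule.

(** The map a ⊗ b |-> p a ⊗ b, which transports tensors from S ⊗_R S, where the
    Galois map can be inverted, to P ⊗_R S. *)
Definition lmul (P : rmodule S) (p : P) (x : ext_tensor psi (res_rmodule reg)) :
    ext_tensor psi (res_rmodule P) :=
  \Sw_(a, b <- x) tpure (ract p (a : S)) b.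

Section Lmul.
Variable P : rmodule S.
Implicit Types (p : P) (s : S).

Lemma lmul_bal p : balanced (@ract _ _ (res_rmodule reg)) (fun r (s : S) => psi r * s)
  (fun a b => tpure (ract p (a : S)) b : ext_tensor psi (res_rmodule P)).
Proof.
split=> [b|a|a r b]; [by lin|by lin|].
rewrite -(bal_mid (tpure_balanced (@ract _ _ (res_rmodule P))
  (fun r (s : S) => psi r * s))).
by congr (tpure _ _); rewrite /= /res_ract ractA.
Qed.

Lemma lmul_linear p : linear (lmul p).
Proof. by apply: tlift_linear; exact: lmul_bal. Qed.

Lemma lmul_linl x : linear (fun p => lmul p x).
Proof. by rewrite /lmul; lin. Qed.

Lemma lmulA p s x : lmul p (lmul (s : reg) x) = lmul (ract p s) x.
Proof.
have b := lmul_bal p; rewrite /lmul sw_sw //; apply: eq_sw => a c.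
by rewrite sw_pure //= ractA.
Qed.

Lemma can_map_lmul p x :
  can_map (lmul p x) = \Sw_(t, h <- can_map x) ract p (t : S) ⊗ h.
Proof.
rewrite /can_map /lmul sw_sw; last exact: can_map_bal.
rws @sw_sw; apply: eq_sw => a b; rewrite sw_pure; last exact: can_map_bal.
rws @sw_sw; apply: eq_sw => t h; rws @sw_pure.
by rewrite /= ractA.
Qed.

End Lmul.

Section Galois.
Hypothesis galois : bijective (@galois_map k H S).

Lemma galois_section : exists G : S ⨂ H -> ext_tensor psi (res_rmodule reg),
  [/\ linear G, cancel (@can_map reg) G & cancel G (@can_map reg)].
Proof.
have [G canK GK] := galois; exists G; split=> // c x y.
by apply: (can_inj canK); rewrite GK [RHS](can_map_linear (P := reg)) ![can_map _]GK.
Qed.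

(** With τ(h) the preimage of 1 ⊗ h under the Galois map, the inverse sends
    p ⊗ h to p τ(h). It is a left inverse because s0 τ(s1) = 1 ⊗ s, both sides
    having image s0 ⊗ s1 under the Galois map. *)
Lemma can_map_bijective (P : rmodule S) : bijective (@can_map P).
Proof.
have [G [lG canK GK]] := galois_section.
pose inv (z : P ⨂ H) := \Sw_(p, h <- z) lmul p (G ((1 : S) ⊗ h)).
have ll x := @lmul_linl P x.
have b : kbilinear (fun (p : P) (h : H) => lmul p (G ((1 : S) ⊗ h))).
  apply: balancedP => [h|p]; first exact: ll.
  by apply: lin_app (lmul_linear p) _; lin.
have linv : linear inv by exact: tlift_linear.
have lcan := @can_map_linear P.
exists inv => [x|z]; last first.
  rewrite -[RHS]sw_id /inv sw_push //; apply: eq_sw => p h.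
  by rewrite can_map_lmul GK; rws @sw_pure; rewrite ract1.
move: x; apply: (tensor_ext (f := inv \o can_map (P:=P)) (g := id)) => [||p s] //.
  exact: lin_comp.
have -> : (inv \o can_map (P:=P)) (tpure p s)
    = lmul p (\Sw_(t, h <- coact s) lmul (t : reg) (G ((1 : S) ⊗ h))).
  rewrite /= can_map_pure /inv sw_sw // (sw_push _ _ (lmul_linear p)).
  by apply: eq_sw => t h; rewrite sw_pure // lmulA.
suff -> : \Sw_(t, h <- coact s) lmul (t : reg) (G ((1 : S) ⊗ h))
    = tpure (1 : S) s.
  by rewrite /lmul sw_pure ?ract1 //; exact: lmul_bal.
apply: (can_inj canK); rewrite can_map_pure.
rewrite (sw_push _ _ (can_map_linear (P := reg))); apply: eq_sw => t h.
by rewrite can_map_lmul GK; rws @sw_pure; rewrite /= mulr1 mul1r.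
Qed.

End Galois.
End Canonical.

(** * Faithfully flat descent for Hopf modules *)

Lemma ract0 (k : comNzRingType) (R : algType k) (P : rmodule R) r :
  ract (0 : P) r = 0.
Proof. by have := lin_scale 0 (0 : P) (ract_linl r); rewrite !scale0r. Qed.

Section Kernel.
Variables (k : comNzRingType) (R : algType k) (V W : rmodule R).
Variable g : {linear V -> W}.
Hypothesis gr : forall v r, g (ract v r) = ract (g v) r.

(** The kernel as a module of its own, in order that exactness can be stated
    for it. *)
Definition in_ker : {pred V} := fun v => g v == 0.

Fact in_ker_submod : GRing.subsemimod_closed in_ker.
Proof.
apply: GRing.submod_closed_semi; split=> [|c x y /eqP gx /eqP gy].
  by rewrite unfold_in raddf0.
by rewrite unfold_in linearP gx gy scaler0 addr0.
Qed.

Record ker_of := Ker { ker_val : V; ker_valP : ker_val \in in_ker }.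
HB.instance Definition _ := [isSub for ker_val].
HB.instance Definition _ := [Choice of ker_of by <:].
HB.instance Definition _ :=
  GRing.SubChoice_isSubLmodule.Build k V in_ker ker_of in_ker_submod.

Fact ker_ract_subproof (x : ker_of) r : ract (ker_val x) r \in in_ker.
Proof.
have /eqP gx := ker_valP x; rewrite unfold_in gr gx.
by rewrite ract0.
Qed.

Definition ker_ract x r : ker_of := Ker (ker_ract_subproof x r).

Definition ker_rmodule : rmodule R.
Proof.
refine (@RModule k R ker_of ker_ract _ _ _ _).
- by move=> r c x y; apply: val_inj; rewrite /= ract_linl.
- by move=> x c r r'; apply: val_inj; rewrite /= ract_linr.
- by move=> x; apply: val_inj; rewrite /= ract1.
- by move=> x r r'; apply: val_inj; rewrite /= ractA.
Defined.

Lemma ker_val_rlinear : rlinear (ker_val : ker_rmodule -> V).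
Proof. by split. Qed.

Lemma ker_exact : exact_at (ker_val : ker_rmodule -> V) g.
Proof.
move=> v; split=> [gv|[x <-]]; last exact/eqP/ker_valP.
by have kv : v \in in_ker by [rewrite unfold_in gv]; exists (Ker kv).
Qed.

End Kernel.

Section Descent.
Variables (k : comNzRingType) (H : hopfAlgType k) (S : comodAlgType H).
Local Notation R := (coinv S).
Local Notation psi := (@coinv_incl k H S).

Lemma ext_map_bal (V W : rmodule R) (f : V -> W) : rlinear f ->
  balanced (@ract _ _ V) (fun r (s : S) => psi r * s)
    (fun v s => tpure (f v) s : ext_tensor psi W).
Proof.
move=> rf; have lf := rlinear_linear rf.
split=> [s|v|v r s]; [by lin|by lin|].
by rewrite rf.2 (bal_mid (tpure_balanced _ _)).
Qed.

Lemma ext_map_linear (V W : rmodule R) (f : V -> W) : rlinear f ->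
  linear (@ext_map k R S psi V W f).
Proof. by move=> rf; apply: tlift_linear; exact: ext_map_bal. Qed.

Lemma ext_map_pure (V W : rmodule R) (f : V -> W) v s : rlinear f ->
  @ext_map k R S psi V W f (tpure v s) = tpure (f v) s.
Proof. by move=> rf; apply: tlift_pure; exact: ext_map_bal. Qed.

Section Diagonal.
Variable P : rmodule S.

(** The action (p ⊗ h) s = p s0 ⊗ h s1, for which a Hopf module coaction is
    S-linear. Over the coinvariants it is the action on the first factor. *)
Definition diag_ract (z : P ⨂ H) (s : S) : P ⨂ H :=
  \Sw_(p, h <- z) \Sw_(t, l <- coact s) ract p t ⊗ (h * l).

Let lc : linear (@coact k H S). Proof. exact: linearP. Qed.

Lemma diag_ract_linl s : linear (diag_ract^~ s).
Proof. by rewrite /diag_ract; lin. Qed.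
Lemma diag_ract_linr z : linear (diag_ract z).
Proof. by rewrite /diag_ract; lin. Qed.
Lemma diag_ract1 z : diag_ract z 1 = z.
Proof.
rewrite /diag_ract coact1 -[RHS]sw_id; apply: eq_sw => p h.
by rws @sw_pure; rewrite ract1 mulr1.
Qed.
Lemma diag_ractA z s t : diag_ract (diag_ract z s) t = diag_ract z (s * t).
Proof.
rewrite /diag_ract coactM; rws @sw_sw; apply: eq_sw => p h.
rws @sw_sw; rws @tprod_sw; apply: eq_sw => u l; rws @sw_pure.
by apply: eq_sw => v l'; rewrite ractA mulrA.
Qed.

Definition diag_rmodule : rmodule S :=
  RModule diag_ract_linl diag_ract_linr diag_ract1 diag_ractA.
End Diagonal.
End Descent.

Lemma tassocK (k : comNzRingType) (A B C : lmodType k) :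
  cancel (@tassoc k A B C) (@tassoc_inv k A B C).
Proof.
move=> x; rewrite -[RHS]sw_id /tassoc_inv; rws @sw_tassoc.
apply: eq_sw => z c; rewrite -[X in _ = X ⊗ c]sw_id.
rewrite (sw_push (f := fun z => z ⊗ c)); last exact: pure_linl.
by apply: eq_sw => a b; rws @sw_pure.
Qed.

Lemma linB (k : comNzRingType) (P Q : lmodType k) (f : P -> Q) x y :
  linear f -> f (x - y) = f x - f y.
Proof.
by move=> lf; rewrite -scaleN1r addrC lf scaleN1r addrC.
Qed.

Lemma rlinearB (k : comNzRingType) (R : algType k) (V W : rmodule R)
    (f g : V -> W) :
  rlinear f -> rlinear g -> rlinear (fun v => f v - g v).
Proof.
move=> [fD fr] [gD gr]; split=> [x y|v r]; first by rewrite fD gD opprD addrACA.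
by rewrite fr gr (linB _ _ (ract_linl r)).
Qed.

Lemma ext_mapB (k : comNzRingType) (R S : algType k) (psi : {lrmorphism R -> S})
    (V W : rmodule R) (f g : V -> W) x :
  @ext_map k R S psi V W (fun v => f v - g v) x
  = @ext_map k R S psi V W f x - @ext_map k R S psi V W g x.
Proof.
rewrite /ext_map /tlift /tsum -sumrB; apply: eq_bigr => p _.
by rewrite (linB _ _ (bal_linl (tpure_balanced _ _) p.2)).
Qed.

Section Coinvariants.
Variables (k : comNzRingType) (H : hopfAlgType k) (S : comodAlgType H).
Variable M : hopf_module S.
Local Notation R := (coinv S).
Local Notation psi := (@coinv_incl k H S).
Local Notation dM := (hmod_coact M).
Local Notation W := (diag_rmodule M).
Local Notation ext f := (@ext_map k R S psi (res_rmodule M) (res_rmodule W) f).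

Let lc : linear (@coact k H S). Proof. exact: linearP. Qed.
Let ld : linear dM. Proof. exact: linearP. Qed.
Let lh : linear (@hcomul k H). Proof. exact: linearP. Qed.

(** The coinvariants are the equalizer of the coaction and of this map. *)
Definition trivial_coact : M -> M ⨂ H := fun m => m ⊗ 1.

Lemma coact_diag m s : dM (ract m s) = @diag_ract k H S M (dM m) s.
Proof. by rewrite hmod_coactM. Qed.

Lemma coact_rlinear : rlinear (dM : res_rmodule M -> res_rmodule W).
Proof. by split=> [x y|m r]; [exact: raddfD|exact: coact_diag]. Qed.

Lemma trivial_coact_rlinear : rlinear (trivial_coact : res_rmodule M -> res_rmodule W).
Proof.
split=> [x y|m r]; first by have := pure_linl (1 : H) 1 x y; rewrite !scale1r.
rewrite /= /res_ract /= /diag_ract coact_coinv /trivial_coact.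
by rws @sw_pure; rws @sw_pure; rewrite mulr1.
Qed.

(** The coaction is S-linear for the diagonal action, so the canonical maps are
    natural with respect to it. *)
Lemma can_map_ext_coact x : can_map (ext dM x) = tmap dM id (can_map x).
Proof.
move: x; apply: (tensor_ext (f := @can_map _ _ _ W \o ext dM)
  (g := tmap dM id \o @can_map _ _ _ M)) => [||m s].
- exact: lin_comp (@can_map_linear _ _ _ _) (ext_map_linear coact_rlinear).
- by apply: lin_comp (@can_map_linear _ _ _ _); apply: tmap_linear.
rewrite /= (ext_map_pure _ _ coact_rlinear) !can_map_pure.
have lt : linear (tmap dM (@id H)) by exact: tmap_linear.
rewrite sw_push //; apply: eq_sw => t h.
by rewrite tmapE // coact_diag.
Qed.

(** On m ⊗ s both sides are m s0 ⊗ s1 ⊗ s2. With the preceding lemma, this turns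
    the comparison of the two maps on an x with image m0 ⊗ m1 into the
    coassociativity of the coaction of M. *)
Lemma can_map_ext_trivial x :
  can_map (ext trivial_coact x) = tassoc_inv (tmap id hcomul (can_map x)).
Proof.
have la : linear (@tassoc_inv k M H H) by apply: tlift_linear; lin.
have lt : linear (tmap (@id M) (@hcomul k H)) by exact: tmap_linear.
move: x; apply: (tensor_ext (f := @can_map _ _ _ W \o ext trivial_coact)
  (g := (@tassoc_inv _ _ _ _ \o tmap id hcomul) \o @can_map _ _ _ M)) => [||m s].
- exact: lin_comp (@can_map_linear _ _ _ _) (ext_map_linear trivial_coact_rlinear).
- by apply: lin_comp (@can_map_linear _ _ _ _); exact: lin_comp.
rewrite /= (ext_map_pure _ _ trivial_coact_rlinear) !can_map_pure /=.
transitivity (\Sw_(t, h <- coact s) \Sw_(t', l <- coact (t : S))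
    (ract (m : M) t' ⊗ l) ⊗ h).
  apply: eq_sw => t h; rewrite /diag_ract /trivial_coact; rws @sw_pure.
  rewrite (sw_push (f := fun z => z ⊗ h)); last exact: pure_linl.
  by apply: eq_sw => t' l; rewrite mul1r.
rewrite (coassoc_sw (T := fun t l h => (ract (m : M) t ⊗ l) ⊗ h)) //;
  [|exact: coactP|by lin].
rewrite (sw_push (f := fun z : M ⨂ H => tassoc_inv (tmap id hcomul z)));
  last exact: lin_comp.
apply: eq_sw => t h; rewrite /= tmapE // /tassoc_inv; rws @sw_pure.
by [].
Qed.

(** The action map P ⊗_R S -> P is read off from the canonical map by applying
    the counit. *)
Lemma counit_can_map (P : rmodule S) (x : ext_tensor psi (res_rmodule P)) :
  \Sw_(a, h <- can_map x) (hcounit h : k) *: a = \Sw_(p, s <- x) ract (p : P) s.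
Proof.
rewrite /can_map; rws @sw_sw; apply: eq_sw => p s; rws @sw_sw.
rewrite -[in RHS](counit_sw s (@coactP _ _ S)) (sw_push _ _ (ract_linr (p : P))).
apply: eq_sw => t h; rws @sw_pure.
by rewrite -(lin_scale _ _ (ract_linr (p : P))).
Qed.

Lemma ract_bal (P : rmodule S) : balanced (@ract _ _ (res_rmodule P))
  (fun r (s : S) => psi r * s) (@ract _ _ P).
Proof.
split=> [s|p|p r s]; [exact (@ract_linl k S P s)|exact (@ract_linr k S P p)|].
by rewrite /= /res_ract ractA.
Qed.

(** The coinvariants N span M over S: the preimage x of m0 ⊗ m1 under the
    canonical map is killed by the difference g of the two maps to M ⊗ H, so
    flatness brings it from N ⊗_R S, and the action map sends it to m. *)
Theorem hopf_descent : hopf_galois S -> forall m, exists s : seq (M * S),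
  (forall p, p \in s -> dM p.1 = p.1 ⊗ 1) /\ m = \sum_(p <- s) ract p.1 p.2.
Proof.
move=> [flat galois] m.
have [th _ canK] := can_map_bijective galois M.
pose x := th (dM m).
have rg := rlinearB coact_rlinear trivial_coact_rlinear.
pose g : {linear res_rmodule M -> res_rmodule W} :=
  HB.pack (fun m : res_rmodule M => dM m - trivial_coact m : res_rmodule W)
  (GRing.isLinear.Build _ _ _ _ _ (rlinear_linear rg)).
have gr : forall v r, g (@ract _ _ (res_rmodule M) v r)
    = @ract _ _ (res_rmodule W) (g v) r := rg.2.
have [ex _] := flat _ _ _ _ _ (ker_val_rlinear gr) rg.
have gx : ext g x = 0.
  rewrite ext_mapB; apply/eqP; rewrite subr_eq0; apply/eqP.
  apply: (bij_inj (can_map_bijective galois _)).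
  rewrite can_map_ext_coact can_map_ext_trivial.
  rewrite canK -(@tassocK _ _ _ _ (tmap dM id (dM m))).
  by have [-> _] := hmod_coactP M.
have [y xy] := (ex (ker_exact gr) x).1 gx.
exists [seq (ker_val p.1, p.2) | p <- repr y]; split.
  move=> _ /mapP[p _ ->]; have /eqP := ker_valP p.1.
  by move/eqP; rewrite subr_eq0 => /eqP.
rewrite big_map -[LHS](counit_sw m (hmod_coactP M)) -(canK (dM m)) -/x -xy.
have b := ract_bal M.
rewrite counit_can_map [LHS](sw_sw _ _ b).
by apply: eq_bigr => p _; rewrite (sw_pure _ _ b).
Qed.
End Coinvariants.

(** * Bases over a division algebra *)

Section Bases.
Variables (k : comNzRingType) (L : algType k) (M : rmodule L) (n : nat).
Implicit Types (v : 'I_n -> M) (u : 'I_n -> L) (x : M -> 'I_n -> L).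

Definition lincomb v u : M := \sum_i ract (v i) (u i).

(** A basis comes with its coordinate functions [x]; their linearity follows
    from their being inverse to [lincomb v]. *)
Definition is_basis v x :=
  (forall m, lincomb v (x m) = m) /\ (forall u i, x (lincomb v u) i = u i).

Lemma lincombD v u u' :
  lincomb v (fun i => u i + u' i) = lincomb v u + lincomb v u'.
Proof.
rewrite /lincomb -big_split; apply: eq_bigr => i _.
by have := ract_linr (v i) 1 (u i) (u' i); rewrite !scale1r.
Qed.

Lemma lincomb_ract v u s : lincomb v (fun i => u i * s) = ract (lincomb v u) s.
Proof.
rewrite /lincomb (lin_sum _ _ (ract_linl s)).
by apply: eq_bigr => i _; rewrite ractA.
Qed.

Lemma eq_lincomb v u u' : u =1 u' -> lincomb v u = lincomb v u'.
Proof. by move=> e; apply: eq_bigr => i _; rewrite e. Qed.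

Lemma lincomb_delta v i : lincomb v (fun j => (j == i)%:R) = v i.
Proof.
rewrite /lincomb (bigD1 i) //= eqxx ract1 big1 ?addr0 // => j /negPf ->.
by have := lin_scale 0 0 (ract_linr (v j)); rewrite !scale0r.
Qed.

Section Coordinates.
Variables (v : 'I_n -> M) (x : M -> 'I_n -> L).
Hypothesis vx : is_basis v x.

Lemma coordD m m' i : x (m + m') i = x m i + x m' i.
Proof. by rewrite -{1}(vx.1 m) -{1}(vx.1 m') -lincombD vx.2. Qed.

Lemma coord_ract m s i : x (ract m s) i = x m i * s.
Proof. by rewrite -{1}(vx.1 m) -lincomb_ract vx.2. Qed.

Lemma coord_basis i j : x (v i) j = (j == i)%:R.
Proof. by rewrite -lincomb_delta vx.2. Qed.

Lemma coord_sum (T : Type) (s : seq T) (F : T -> M) i :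
  x (\sum_(p <- s) F p) i = \sum_(p <- s) x (F p) i.
Proof.
have x0 : x 0 i = 0 by apply: (addrI (x 0 i)); rewrite -coordD !addr0.
by elim: s => [|p s IH]; rewrite ?big_nil ?big_cons // coordD IH.
Qed.

(** The new coordinates subtract from m the multiple of w whose l-th coordinate
    is that of m. *)
Lemma basis_exchange w l c : x w l * c = 1 -> c * x w l = 1 ->
  exists x', is_basis (fun i => if i == l then w else v i) x'.
Proof.
move=> wc cw.
exists (fun m i => if i == l then c * x m l else x m i - x w i * (c * x m l)).
have lc u : lincomb (fun i => if i == l then w else v i) u
    = lincomb v (fun i => x w i * u l + (if i == l then 0 else u i)).
  rewrite lincombD lincomb_ract vx.1 /lincomb (bigD1 l) //= eqxx; congr (_ + _).
  rewrite [RHS](bigD1 l) //= eqxx.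
  have -> : ract (v l) 0 = 0.
    by have := lin_scale 0 0 (ract_linr (v l)); rewrite !scale0r.
  by rewrite add0r; apply: eq_bigr => i /negPf ->.
split=> [m|u i].
  rewrite lc -[RHS]vx.1; apply: eq_lincomb => i; rewrite eqxx.
  by case: eqP => [->|_]; [rewrite mulrA wc mul1r addr0|rewrite addrC subrK].
rewrite lc !vx.2 eqxx addr0 (mulrA c) cw mul1r.
by case: eqP => [->|_] //; rewrite addrC addKr.
Qed.

End Coordinates.

(** A spanning set contains a basis of the same size as any given one. The
    vectors are exchanged one index at a time; at index l some element of N has
    nonzero l-th coordinate, since otherwise the l-th coordinate would vanish on
    all of M, but it is 1 on the l-th basis vector. *)
Lemma basis_of_spanning (N : M -> Prop) v x : division_algebra L ->
  (forall m, exists s : seq (M * L),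
     (forall p, p \in s -> N p.1) /\ m = \sum_(p <- s) ract p.1 p.2) ->
  is_basis v x -> exists v' x', is_basis v' x' /\ forall i, N (v' i).
Proof.
move=> divL spanN vx.
suff /(_ n (leqnn n)) [v' [x' [vx' Nv']]] : forall j, (j <= n)%N ->
    exists v' x', is_basis v' x' /\ forall i : 'I_n, (i < j)%N -> N (v' i).
  by exists v', x'; split=> // i; apply: Nv'.
elim=> [|j IH] jn; first by exists v, x.
have [v' [x' [vx' Nv']]] := IH (ltnW jn).
pose l := Ordinal jn.
have [w Nw wl] : exists2 w, N w & x' w l != 0.
  apply: contrapT => no; have [s [Ns vl]] := spanN (v' l).
  have := coord_basis vx' l l; rewrite eqxx vl (coord_sum vx') big_seq big1.
    by move/eqP; rewrite eq_sym oner_eq0.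
  move=> p ps; rewrite (coord_ract vx'); have [->|nz] := eqVneq (x' p.1 l) 0.
    by rewrite mul0r.
  by case: no; exists p.1 => //; exact: Ns.
have [c [wc cw]] := divL _ wl.
have [x'' vx''] := basis_exchange vx' wc cw.
exists (fun i => if i == l then w else v' i), x''; split=> // i.
have [//|il] := eqVneq i l; rewrite ltnS leq_eqVlt => /orP[/eqP ij|]; last exact: Nv'.
by case/eqP: il; exact: val_inj.
Qed.

End Bases.

(** * Comparing Hopf modules with coinvariant bases *)

Section StandardBasis.
Variables (k : comNzRingType) (H : hopfAlgType k) (L : comodAlgType H) (n : nat).
Local Notation K := (coinv L).
Local Notation psi := (@coinv_incl k H L).
Local Notation M := (ext_hopf_module (free_rmodule K n)).

Definition std_vec (i : 'I_n) : free_rmodule K n := [ffun j => (j == i)%:R].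
Definition std_basis (i : 'I_n) : M := epure (std_vec i) 1.
Definition std_coord (m : M) (i : 'I_n) : L :=
  tlift (fun (v : free_rmodule K n) (s : L) => psi (v i) * s) m.

Lemma std_coord_bal i : balanced (@ract _ _ (free_rmodule K n))
  (fun r (s : L) => psi r * s) (fun v s => psi (v i) * s : L).
Proof.
split=> [s c v v'|v|v r s].
- by rewrite ffunE ffunE linearP mulrDl -scalerAl.
- by lin.
by rewrite ffunE rmorphM mulrA.
Qed.

Lemma std_ract i s : ract (std_basis i) s = epure (std_vec i) s.
Proof. by rewrite -[in RHS](mul1r s); exact: ext_ractE. Qed.

Lemma std_coord_pure v s i : std_coord (epure v s) i = psi (v i) * s.
Proof. by apply: tlift_pure; exact: std_coord_bal. Qed.

Lemma std_is_basis : is_basis std_basis std_coord.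
Proof.
have lx i : linear (std_coord^~ i) by apply: tlift_linear; exact: std_coord_bal.
split=> [m|u i]; last first.
  transitivity (\sum_j (i == j)%:R * u j).
    rewrite /lincomb (lin_sum _ _ (lx i)); apply: eq_bigr => j _; cbv beta.
    by rewrite [X in std_coord X]std_ract std_coord_pure ffunE rmorph_nat.
  rewrite (bigD1 i) //= eqxx mul1r big1 ?addr0 // => j /negPf ji.
  by rewrite eq_sym ji mul0r.
move: m; apply: (tensor_ext (f := fun m => lincomb std_basis (std_coord m))
  (g := id)) => [c m m'||v s] //.
  rewrite /lincomb scaler_sumr -big_split; apply: eq_bigr => i _.
  by rewrite lx (ract_linr (std_basis i)).
transitivity (\sum_i epure (std_vec i) (psi (v i) * s)).
  by apply: eq_bigr => i _; rewrite std_ract; congr epure; exact: std_coord_pure.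
transitivity (\sum_i epure (ract (std_vec i) (v i)) s).
  by apply: eq_bigr => i _; rewrite [RHS](bal_mid (tpure_balanced _ _)).
rewrite -(lin_sum _ _ (epure_linl s)); congr epure.
apply/ffunP => j; rewrite sum_ffunE (bigD1 j) //= big1 => [|i /negPf ij].
  by rewrite !ffunE eqxx mul1r addr0.
by rewrite !ffunE eq_sym ij mul0r.
Qed.

Lemma std_coact i : hmod_coact M (std_basis i) = std_basis i ⊗ 1.
Proof.
rewrite [LHS]ext_coactE coact1 tmapE //; exact: epure_linr.
Qed.

End StandardBasis.

Section Isomorphism.
Variables (k : comNzRingType) (H : hopfAlgType k) (L : comodAlgType H) (n : nat).

Lemma coact_lincomb (M : hopf_module L) (v : 'I_n -> M) u :
  (forall i, hmod_coact M (v i) = v i ⊗ 1) ->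
  hmod_coact M (lincomb v u) = \sum_i tmap (ract (v i)) id (coact (u i)).
Proof.
move=> cv; rewrite (lin_sum _ _ (@hmod_coact_linear _ _ _ M)); apply: eq_bigr => i _.
rewrite hmod_coactM cv tprod_purel => [||h]; [|exact: ract_linl|exact: mul_linl].
by apply: eq_sw => t h; rewrite mul1r.
Qed.

Variables (M M' : hopf_module L) (e : 'I_n -> M) (x : M -> 'I_n -> L).
Variables (v : 'I_n -> M') (y : M' -> 'I_n -> L).
Hypotheses (ex : is_basis e x) (vy : is_basis v y).
Hypotheses (ce : forall i, hmod_coact M (e i) = e i ⊗ 1).
Hypotheses (cv : forall i, hmod_coact M' (v i) = v i ⊗ 1).

Definition change_basis (m : M) : M' := lincomb v (x m).

Lemma change_basis_rlinear : rlinear change_basis.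
Proof.
split=> [m m'|m s]; rewrite /change_basis -?lincombD -?lincomb_ract;
  apply: eq_lincomb => i.
- exact: (coordD ex).
- exact: (coord_ract ex).
Qed.

(** On a coinvariant basis the coaction is determined by that of S: it sends
    the sum of the e_i u_i to the sum of the e_i (u_i)0 ⊗ (u_i)1. *)
Lemma change_basis_coact m :
  hmod_coact M' (change_basis m) = tmap change_basis id (hmod_coact M m).
Proof.
have lg := rlinear_linear change_basis_rlinear.
rewrite -{2}(ex.1 m) !coact_lincomb // lin_sum; last first.
  by apply: tmap_linear.
apply: eq_bigr => i _; rewrite tmap_comp //; try exact: ract_linr.
apply: eq_sw => t h; congr (_ ⊗ _) => /=.
rewrite /change_basis -lincomb_delta -lincomb_ract; apply: eq_lincomb => j.
by rewrite (coord_ract ex) (coord_basis ex).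
Qed.

End Isomorphism.

Lemma change_basisK (k : comNzRingType) (L : algType k) (M : rmodule L) n
  (e v : 'I_n -> M) x y : is_basis e x -> is_basis v y ->
  cancel (fun m => lincomb v (x m)) (fun m => lincomb e (y m)).
Proof.
move=> ex vy m; rewrite -[RHS]ex.1; apply: eq_lincomb => i; exact: vy.2.
Qed.

(** A cocycle twists M into a Hopf module on the same S-module; descent gives it
    a coinvariant basis of the same size as e, and matching the two bases is an
    isomorphism from M to the twisted module. *)
Theorem H1_coinvariant_basis (k : comNzRingType) (H : hopfAlgType k)
    (S : comodAlgType H) (M : hopf_module S) n (e : 'I_n -> M) x :
  division_algebra S -> hopf_galois S -> is_basis e x ->
  (forall i, hmod_coact M (e i) = e i ⊗ 1) -> H1 M = [set H1_point M]%classic.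
Proof.
move=> divS galois ex ce; apply: H1_trivial => Phi ZPhi.
pose M' := twisted_module ZPhi.
have [v [y [vy cv]]] :=
  basis_of_spanning (N := fun m : M' => hmod_coact M' m = m ⊗ 1) divS
    (hopf_descent (M := M') galois) ex.
pose f : raut M := @RAut _ _ _ M _ (fun m => lincomb v (x m))
  (change_basis_rlinear (M := M') (M' := M) e vy)
  (change_basisK vy ex) (change_basisK ex vy).
exists f; apply: Z1_act_point => [|m]; first by have [] := ZPhi.
exact: (change_basis_coact (M := M) (M' := M') ex ce cv m).
Qed.

Theorem corollary1p3 (k : comNzRingType) (H : hopfAlgType k)
    (L : comodAlgType H) (n : nat)
    (H_fg : finitely_generated H) (H_proj : projective H)
    (K_div : division_algebra (coinv L)) (L_div : division_algebra L)
    (KL_galois : hopf_galois L) (n_gt0 : (0 < n)%N) :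
  (H1 (ext_hopf_module (free_rmodule (coinv L) n))
   = [set H1_point (ext_hopf_module (free_rmodule (coinv L) n))])%classic.
Proof.
exact: H1_coinvariant_basis L_div KL_galois (@std_is_basis k H L n)
  (@std_coact k H L n).
Qed.
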